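(* Let $Y$ be a compact set in $\mathbb{C}^N$ such that $\widehat{Y}\setminus Y\neq\emptyset$ and $P(Y)$ has dense invertibles. Then there exists a compact set $X$ in $\mathbb{C}^{N+1}$ such that, letting $\pi$ denote the restriction to $\widehat{X}$ of the projection $\mathbb{C}^{N+1}\to\mathbb{C}^N$ onto the first $N$ coordinates: (i) $\pi(X)=Y$; (ii) $\pi(\widehat{X}\setminus X)=\widehat{Y}\setminus Y$; (iii) $P(X)$ has dense invertibles; (iv) every point of $\widehat{X}$ is a one-point Gleason part for $P(X)$ and there are no nonzero bounded point derivations for $P(X)$; (v) for each $z\in\widehat{Y}$ the fiber $\pi^{-1}(z)$ is a Cantor set.
   Context: For compact $X\subset\mathbb{C}^N$, $\widehat{X}=\{z: |p(z)|\le\max_X|p| \text{ for all polynomials } p\}$ is the polynomial hull, which is naturally identified with the maximal ideal space of $P(X)$, the uniform closure on $X$ of the polynomials in the coordinate functions. A uniform algebra has dense invertibles if its invertible elements are dense in it. For a uniform algebra $A$, the Gleason parts are the equivalence classes of the maximal ideal space under $\varphi\sim\psi$ iff $\|\varphi-\psi\|<2$ in the dual norm of $A^*$. For a multiplicative linear functional $\phi$ on $A$, a point derivation at $\phi$ is a linear functional $\psi$ with $\psi(fg)=\psi(f)\phi(g)+\phi(f)\psi(g)$ for all $f,g\in A$; it is bounded if it is continuous. *)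

(* Defs.v *)
From Stdlib Require Import Reals List.
Open Scope R_scope.

Record C := mkC { Re : R; Im : R }.
Definition C0 : C := mkC 0 0.
Definition C1 : C := mkC 1 0.
Definition Cadd (a b : C) : C := mkC (Re a + Re b) (Im a + Im b).
Definition Copp (a : C) : C := mkC (- Re a) (- Im a).
Definition Csub (a b : C) : C := Cadd a (Copp b).
Definition Cmul (a b : C) : C :=
  mkC (Re a * Re b - Im a * Im b) (Re a * Im b + Im a * Re b).
Definition Cnorm (a : C) : R := sqrt (Re a * Re a + Im a * Im a).

(** Points of C^N: sequences nat -> C vanishing at coordinates >= N
    (coordinates are indexed 0..N-1). *)
Definition Vec := nat -> C.
Definition inCN (N : nat) (v : Vec) : Prop := forall k, (N <= k)%nat -> v k = C0.

Fixpoint sumsq (n : nat) (f : nat -> R) : R :=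
  match n with O => 0 | S m => sumsq m f + f m * f m end.
Definition dist (N : nat) (v w : Vec) : R :=
  sqrt (sumsq N (fun k => Cnorm (Csub (v k) (w k)))).

Definition openN (N : nat) (U : Vec -> Prop) : Prop :=
  forall v, inCN N v -> U v ->
    exists r, 0 < r /\ forall w, inCN N w -> dist N v w < r -> U w.

Definition compactN (N : nat) (X : Vec -> Prop) : Prop :=
  (forall v, X v -> inCN N v) /\
  forall (I : Type) (U : I -> Vec -> Prop),
    (forall i, openN N (U i)) ->
    (forall v, X v -> exists i, U i v) ->
    exists l : list I, forall v, X v -> exists i, In i l /\ U i v.

Definition fadd (f g : Vec -> C) : Vec -> C := fun v => Cadd (f v) (g v).
Definition fsub (f g : Vec -> C) : Vec -> C := fun v => Csub (f v) (g v).
Definition fmul (f g : Vec -> C) : Vec -> C := fun v => Cmul (f v) (g v).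

Inductive is_poly (N : nat) : (Vec -> C) -> Prop :=
| poly_const : forall c : C, is_poly N (fun _ => c)
| poly_coord : forall k, (k < N)%nat -> is_poly N (fun v => v k)
| poly_add : forall p q, is_poly N p -> is_poly N q -> is_poly N (fadd p q)
| poly_mul : forall p q, is_poly N p -> is_poly N q -> is_poly N (fmul p q).

Definition bounded_by (X : Vec -> Prop) (f : Vec -> C) (M : R) : Prop :=
  forall x, X x -> Cnorm (f x) <= M.

Definition hull (N : nat) (X : Vec -> Prop) (z : Vec) : Prop :=
  inCN N z /\
  forall p, is_poly N p -> forall M, bounded_by X p M -> Cnorm (p z) <= M.

Definition inP (N : nat) (X : Vec -> Prop) (f : Vec -> C) : Prop :=
  forall eps, 0 < eps -> exists p, is_poly N p /\ bounded_by X (fsub f p) eps.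

Definition invertibleP (N : nat) (X : Vec -> Prop) (g : Vec -> C) : Prop :=
  exists h, inP N X h /\ forall x, X x -> Cmul (g x) (h x) = C1.

Definition dense_invertibles (N : nat) (X : Vec -> Prop) : Prop :=
  forall f, inP N X f -> forall eps, 0 < eps ->
    exists g, inP N X g /\ invertibleP N X g /\ bounded_by X (fsub f g) eps.

(** The character phi_z of P(X) at a point z of the hull (the identification of
    the maximal ideal space with the hull): evalP N X z f c means phi_z(f) = c,
    phi_z being the continuous extension of polynomial evaluation at z. *)
Definition evalP (N : nat) (X : Vec -> Prop) (z : Vec) (f : Vec -> C) (c : C) : Prop :=
  forall eps, 0 < eps -> exists delta, 0 < delta /\
    forall p, is_poly N p -> bounded_by X (fsub f p) delta ->
      Cnorm (Csub (p z) c) <= eps.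

(** ||phi_z - phi_w|| < 2 in the dual norm of P(X) *)
Definition gleason_lt2 (N : nat) (X : Vec -> Prop) (z w : Vec) : Prop :=
  exists r, r < 2 /\
    forall f, inP N X f -> bounded_by X f 1 ->
      forall a b, evalP N X z f a -> evalP N X w f b -> Cnorm (Csub a b) <= r.

Definition one_point_part (N : nat) (X : Vec -> Prop) (z : Vec) : Prop :=
  forall w, hull N X w -> gleason_lt2 N X z w -> w = z.

Definition bounded_point_derivation (N : nat) (X : Vec -> Prop) (z : Vec)
  (psi : (Vec -> C) -> C) : Prop :=
  (forall f g, inP N X f -> inP N X g -> psi (fadd f g) = Cadd (psi f) (psi g)) /\
  (forall (c : C) f, inP N X f -> psi (fmul (fun _ => c) f) = Cmul c (psi f)) /\
  (exists M, forall f s, inP N X f -> bounded_by X f s -> Cnorm (psi f) <= M * s) /\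
  (forall f g a b, inP N X f -> inP N X g -> evalP N X z f a -> evalP N X z g b ->
     psi (fmul f g) = Cadd (Cmul (psi f) b) (Cmul a (psi g))).

Definition proj (N : nat) (v : Vec) : Vec :=
  fun k => if Nat.ltb k N then v k else C0.

(** S (a subset of C^M) is a Cantor set: homeomorphic to the Cantor space
    {0,1}^nat (with the product topology). *)
Definition is_cantor (M : nat) (S : Vec -> Prop) : Prop :=
  exists (f : Vec -> (nat -> bool)) (g : (nat -> bool) -> Vec),
    (forall x, S x -> g (f x) = x) /\
    (forall s, S (g s) /\ f (g s) = s) /\
    (forall x, S x -> forall n, exists delta, 0 < delta /\
       forall y, S y -> dist M x y < delta -> forall k, (k < n)%nat -> f y k = f x k) /\
    (forall s eps, 0 < eps -> exists n, forall t,
       (forall k, (k < n)%nat -> t k = s k) -> dist M (g s) (g t) < eps).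

(* Main.v *)
From Stdlib Require Import Reals List Lra Lia Psatz Classical ClassicalEpsilon
  FunctionalExtensionality PropExtensionality Cantor.
From Coquelicot Require Compactness.
Require Import Defs.
Open Scope R_scope.

(** Starting from the hull of [Y], placed at height [0] in the last coordinate,
    we adjoin one square root at a time: a point [x] is replaced by the two points
    [x +- d e_N] with [d^2 = E_n x], where [E_n] is a small multiple of an
    invertible polynomial [F_n].  If the increments decrease fast enough, each
    finite stage can be recovered by polynomials from the limit point (Newton's
    iteration), so that the limit algebra contains all the adjoined roots although
    it lives in [N + 1] variables.  Dense invertibles pass to each extension, hence
    the [F_n] can be chosen to approximate every polynomial; then squares are
    dense in the limit algebra, and this excludes bounded point derivations and
    nontrivial Gleason parts.  The hull does not grow, since symmetric functions of
    the two conjugates [p (x + d e_N)] and [p (x - d e_N)] are polynomials on the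
    previous stage; and the sign choices make each fibre a Cantor set. *)

(** * Complex numbers *)

(* One extra coordinate must carry infinitely many roots: a limit point has last coordinate
   [d_0 + d_1 + ...], and each [d_n] has to be read off from this sum. If the tail [t] after [d]
   satisfies [|t| <= |d| / 8], then [(d + t)^2 / E = rho^2] with [rho = 1 + t / d] close to 1; this
   singles out [rho], and [d = (d + t) / rho]. So the tail must be small against a lower bound of
   [|d|], that is, [E_n] must be bounded away from 0 on the whole stage. This is where dense
   invertibles enter, and why they have to survive each extension. The tolerance [delta] of a stage
   is fixed before the next root is chosen: that root has modulus at most [delta / 2], and the new
   tolerance is at most [delta / 2] and at most one eighth of a lower bound for the root. The same
   gap separates branches with different signs. Roots are not functions of the base point, and no
   branch has to be continuous. To find the hull of the limit set, the values that a character
   assigns to the stages are shown to form a branch themselves. *)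
Declare Scope cplx_scope.
Delimit Scope cplx_scope with K.
Bind Scope cplx_scope with C.
Infix "+" := Cadd : cplx_scope.
Infix "-" := Csub : cplx_scope.
Infix "*" := Cmul : cplx_scope.
Notation "- x" := (Copp x) : cplx_scope.

Definition Cinv (a : C) : C :=
  mkC (Re a / (Re a * Re a + Im a * Im a)) (- Im a / (Re a * Re a + Im a * Im a)).
Definition Cdiv (a b : C) : C := Cmul a (Cinv b).
Infix "/" := Cdiv : cplx_scope.
Definition RtoC (x : R) : C := mkC x 0.

Lemma C_eq (a b : C) : Re a = Re b -> Im a = Im b -> a = b.
Proof. destruct a, b; simpl; intros; subst; reflexivity. Qed.

Lemma C_field_theory : field_theory C0 C1 Cadd Cmul Csub Copp Cdiv Cinv eq.
Proof.
  split.
  - split; intros; apply C_eq; simpl; ring.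
  - intro H; injection H; lra.
  - reflexivity.
  - intros [a b] H; apply C_eq; simpl; field; intro E; apply H;
      apply C_eq; simpl; nra.
Qed.
Add Field C_field : C_field_theory.

Lemma Cnorm_sqr (a : C) : Cnorm a * Cnorm a = Re a * Re a + Im a * Im a.
Proof. unfold Cnorm; apply sqrt_sqrt; nra. Qed.

Lemma Cnorm_ge0 (a : C) : 0 <= Cnorm a.
Proof. apply sqrt_pos. Qed.

Lemma Cnorm_mul (a b : C) : Cnorm (a * b)%K = Cnorm a * Cnorm b.
Proof.
  unfold Cnorm; rewrite <- sqrt_mult by nra; f_equal; simpl; ring.
Qed.

Lemma Cnorm_add (a b : C) : Cnorm (a + b)%K <= Cnorm a + Cnorm b.
Proof.
  pose proof (Cnorm_ge0 a) as Ha; pose proof (Cnorm_ge0 b) as Hb.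
  pose proof (Cnorm_ge0 (a + b)%K) as Hab.
  pose proof (Cnorm_sqr a) as Qa; pose proof (Cnorm_sqr b) as Qb.
  pose proof (Cnorm_sqr (a + b)%K) as Qab; simpl in Qab.
  assert (CS : Re a * Re b + Im a * Im b <= Cnorm a * Cnorm b).
  { apply Rsqr_incr_0_var; [|nra]; unfold Rsqr.
    replace (Cnorm a * Cnorm b * (Cnorm a * Cnorm b)) with
      ((Cnorm a * Cnorm a) * (Cnorm b * Cnorm b)) by ring.
    rewrite Qa, Qb; pose proof (Rle_0_sqr (Re a * Im b - Im a * Re b)) as Q.
    unfold Rsqr in Q; nra. }
  nra.
Qed.

Lemma Cnorm_opp (a : C) : Cnorm (- a)%K = Cnorm a.
Proof. unfold Cnorm; f_equal; simpl; ring. Qed.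

Lemma Cnorm_sub (a b : C) : Cnorm (a - b)%K <= Cnorm a + Cnorm b.
Proof. unfold Csub; rewrite <- (Cnorm_opp b); apply Cnorm_add. Qed.

Lemma Cnorm_subC (a b : C) : Cnorm (a - b)%K = Cnorm (b - a)%K.
Proof. rewrite <- (Cnorm_opp (a - b)%K); f_equal; ring. Qed.

Lemma Cnorm_tri (a b c : C) : Cnorm (a - c)%K <= Cnorm (a - b)%K + Cnorm (b - c)%K.
Proof. replace (a - c)%K with ((a - b) + (b - c))%K by ring; apply Cnorm_add. Qed.

Lemma Cnorm_le_add (a b : C) : Cnorm a <= Cnorm b + Cnorm (a - b)%K.
Proof. replace a with (b + (a - b))%K at 1 by ring; apply Cnorm_add. Qed.

Lemma Cnorm_RtoC (x : R) : Cnorm (RtoC x) = Rabs x.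
Proof.
  unfold Cnorm; simpl; rewrite Rmult_0_l, Rplus_0_r; apply sqrt_Rsqr_abs.
Qed.

Lemma Cnorm_0 : Cnorm C0 = 0.
Proof. change C0 with (RtoC 0); rewrite Cnorm_RtoC; apply Rabs_R0. Qed.

Lemma Cnorm_1 : Cnorm C1 = 1.
Proof. change C1 with (RtoC 1); rewrite Cnorm_RtoC; apply Rabs_R1. Qed.

Lemma Cnorm_eq0 (a : C) : Cnorm a = 0 -> a = C0.
Proof.
  intro H; pose proof (Cnorm_sqr a) as Q; rewrite H in Q; apply C_eq; simpl; nra.
Qed.

Lemma Cnorm_gt0 (a : C) : a <> C0 -> 0 < Cnorm a.
Proof.
  intro H; destruct (Cnorm_ge0 a) as [h|h]; auto.
  now symmetry in h; apply Cnorm_eq0 in h.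
Qed.

Lemma Cnorm_neq0 (a : C) : 0 < Cnorm a -> a <> C0.
Proof. intros H ->; rewrite Cnorm_0 in H; lra. Qed.

Lemma Csub_eq0 (a b : C) : (a - b)%K = C0 -> a = b.
Proof. intro H; replace a with (b + (a - b))%K by ring; rewrite H; ring. Qed.

Lemma Cmul_eq0 (a b : C) : (a * b)%K = C0 -> a = C0 \/ b = C0.
Proof.
  intro H; destruct (classic (a = C0)) as [|n]; [now left|right].
  apply Cnorm_eq0; apply (f_equal Cnorm) in H.
  rewrite Cnorm_mul, Cnorm_0 in H; apply Cnorm_gt0 in n.
  apply Rmult_integral in H; lra.
Qed.

Lemma Cinv_r (a : C) : a <> C0 -> (a * Cinv a)%K = C1.
Proof. intro; field; auto. Qed.

Lemma Cnorm_inv (a : C) : a <> C0 -> Cnorm (Cinv a) = / Cnorm a.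
Proof.
  intro H; pose proof (Cnorm_gt0 a H).
  pose proof (f_equal Cnorm (Cinv_r a H)) as E; rewrite Cnorm_mul, Cnorm_1 in E.
  apply Rmult_eq_reg_l with (Cnorm a); [|lra]; rewrite E; field; lra.
Qed.

Lemma Cnorm_close0 (a : C) : (forall e, 0 < e -> Cnorm a <= e) -> a = C0.
Proof.
  intro H; apply Cnorm_eq0; pose proof (Cnorm_ge0 a).
  destruct (Req_dec (Cnorm a) 0); auto.
  specialize (H (Cnorm a / 2)); lra.
Qed.

Lemma Re_le_Cnorm (a : C) : Rabs (Re a) <= Cnorm a.
Proof.
  pose proof (Cnorm_sqr a); pose proof (Cnorm_ge0 a).
  apply Rsqr_incr_0; unfold Rsqr; auto using Rabs_pos.
  rewrite <- Rabs_mult, Rabs_pos_eq; nra.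
Qed.

Lemma Im_le_Cnorm (a : C) : Rabs (Im a) <= Cnorm a.
Proof.
  pose proof (Cnorm_sqr a); pose proof (Cnorm_ge0 a).
  apply Rsqr_incr_0; unfold Rsqr; auto using Rabs_pos.
  rewrite <- Rabs_mult, Rabs_pos_eq; nra.
Qed.

Lemma Cnorm_le_ReIm (a : C) : Cnorm a <= Rabs (Re a) + Rabs (Im a).
Proof.
  replace a with (RtoC (Re a) + mkC 0 1 * RtoC (Im a))%K at 1
    by (apply C_eq; simpl; ring).
  eapply Rle_trans; [apply Cnorm_add|]; rewrite Cnorm_mul, !Cnorm_RtoC.
  replace (Cnorm (mkC 0 1)) with 1; [lra|].
  unfold Cnorm; simpl; replace (0 * 0 + 1 * 1) with 1 by ring; now rewrite sqrt_1.
Qed.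

(** * Square roots and completeness of the complex numbers *)

Definition Csqrt (z : C) : C :=
  mkC (sqrt ((Cnorm z + Re z) / 2))
      (if Rle_dec 0 (Im z) then sqrt ((Cnorm z - Re z) / 2)
       else - sqrt ((Cnorm z - Re z) / 2)).

Lemma Csqrt_sqr (z : C) : (Csqrt z * Csqrt z)%K = z.
Proof.
  pose proof (Re_le_Cnorm z) as Hr; pose proof (Rle_abs (Re z)).
  pose proof (Rle_abs (- Re z)) as H'; rewrite Rabs_Ropp in H'.
  assert (P : 0 <= (Cnorm z + Re z) / 2) by lra.
  assert (Q : 0 <= (Cnorm z - Re z) / 2) by lra.
  assert (S : sqrt ((Cnorm z + Re z) / 2) * sqrt ((Cnorm z - Re z) / 2)
              = Rabs (Im z) / 2).
  { rewrite <- sqrt_mult by auto; rewrite <- sqrt_Rsqr_abs.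
    replace ((Cnorm z + Re z) / 2 * ((Cnorm z - Re z) / 2)) with
      (Rsqr (Im z) / Rsqr 2)
      by (pose proof (Cnorm_sqr z); unfold Rsqr; nra).
    rewrite sqrt_div_alt by (unfold Rsqr; lra).
    rewrite (sqrt_Rsqr 2) by lra; reflexivity. }
  pose proof (sqrt_sqrt _ P); pose proof (sqrt_sqrt _ Q).
  apply C_eq; unfold Csqrt; simpl; destruct (Rle_dec 0 (Im z)) as [h|h].
  - lra.
  - rewrite Rmult_opp_opp; lra.
  - rewrite Rabs_pos_eq in S by auto; lra.
  - rewrite Rabs_left in S by lra; lra.
Qed.

Lemma Csqrt_Re_ge0 (z : C) : 0 <= Re (Csqrt z).
Proof. apply sqrt_pos. Qed.

(** [1 - z] factors as [(1 - Csqrt z) (1 + Csqrt z)], and the second factor has modulus at least 1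
    because the principal root has nonnegative real part. *)
Lemma Csqrt_near_1 (z : C) : Cnorm (C1 - Csqrt z)%K <= Cnorm (C1 - z)%K.
Proof.
  replace (C1 - z)%K with ((C1 - Csqrt z) * (C1 + Csqrt z))%K
    by (rewrite <- (Csqrt_sqr z) at 3; ring).
  rewrite Cnorm_mul.
  pose proof (Cnorm_ge0 (C1 - Csqrt z)%K).
  pose proof (Re_le_Cnorm (C1 + Csqrt z)%K) as H1.
  pose proof (Rle_abs (Re (C1 + Csqrt z)%K)) as H2.
  change (Re (C1 + Csqrt z)%K) with (1 + Re (Csqrt z)) in H1, H2.
  pose proof (Csqrt_Re_ge0 z) as H3; nra.
Qed.

Lemma Csqr_roots (a b : C) : (a * a)%K = (b * b)%K -> a = b \/ a = (- b)%K.
Proof.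
  intro H; destruct (Cmul_eq0 (a - b) (a + b)) as [E|E].
  - replace ((a - b) * (a + b))%K with (a * a - b * b)%K by ring; rewrite H; ring.
  - left; now apply Csub_eq0.
  - right; apply Csub_eq0; rewrite <- E; ring.
Qed.

Fixpoint Cpow (a : C) (n : nat) : C :=
  match n with O => C1 | S m => (a * Cpow a m)%K end.

Lemma Cnorm_pow (a : C) (n : nat) : Cnorm (Cpow a n) = Cnorm a ^ n.
Proof. induction n; simpl; [apply Cnorm_1|]; now rewrite Cnorm_mul, IHn. Qed.

Lemma pow_half_le_1 (n : nat) : (1 / 2) ^ n <= 1.
Proof. induction n; simpl; lra. Qed.

Lemma pow_half_small (eps : R) : 0 < eps ->
  exists n0, forall n, (n0 <= n)%nat -> (1 / 2) ^ n <= eps.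
Proof.
  intro H; destruct (pow_lt_1_zero (1 / 2)) with (y := eps) as [n0 Hn]; auto.
  - rewrite Rabs_pos_eq; lra.
  - exists n0; intros n h; specialize (Hn n h).
    rewrite Rabs_pos_eq in Hn; [lra | apply pow_le; lra].
Qed.

(** The rate [e] reappears in the conclusion, so that a limit stays within the tolerance of every
    stage. Real and imaginary parts converge because both are 1-Lipschitz for [Cnorm]. *)
Lemma C_complete (u : nat -> C) (e : nat -> R) :
  (forall eps, 0 < eps -> exists n0, forall n, (n0 <= n)%nat -> e n <= eps) ->
  (forall n m, (n <= m)%nat -> Cnorm (u m - u n)%K <= e n) ->
  exists l, forall n, Cnorm (l - u n)%K <= e n.
Proof.
  intros He Hu.
  assert (K : forall f : C -> R, (forall a b, Rabs (f a - f b) <= Cnorm (a - b)%K) ->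
    exists l, Un_cv (fun n => f (u n)) l).
  { intros f Hf; destruct (R_complete (fun n => f (u n))) as [l Hl]; [|now exists l].
    intros eps Heps; destruct (He (eps / 3)) as [n0 Hn]; [lra|].
    exists n0; intros n m Hn' Hm'; unfold Rdist.
    specialize (Hn n0 (le_n _)).
    eapply Rle_lt_trans; [apply Hf|].
    eapply Rle_lt_trans; [apply Cnorm_tri with (b := u n0)|].
    rewrite (Cnorm_subC (u n0)).
    pose proof (Hu n0 n Hn'); pose proof (Hu n0 m Hm'); lra. }
  destruct (K Re) as [lr Hr].
  { intros a b; pose proof (Re_le_Cnorm (a - b)%K); simpl in *; auto. }
  destruct (K Im) as [li Hi].
  { intros a b; pose proof (Im_le_Cnorm (a - b)%K); simpl in *; auto. }
  exists (mkC lr li); intro n; apply Rle_plus_epsilon; intros eps Heps.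
  destruct (Hr (eps / 2)) as [n1 H1]; [lra|]; destruct (Hi (eps / 2)) as [n2 H2]; [lra|].
  set (m := (n + n1 + n2)%nat).
  specialize (H1 m); specialize (H2 m); unfold Rdist in *.
  eapply Rle_trans; [apply Cnorm_tri with (b := u m)|].
  pose proof (Hu n m ltac:(lia)).
  pose proof (Cnorm_le_ReIm (mkC lr li - u m)%K) as Q; simpl in Q.
  rewrite (Rabs_minus_sym (Re (u m))) in H1; rewrite (Rabs_minus_sym (Im (u m))) in H2.
  unfold Rminus in *; specialize (H1 ltac:(lia)); specialize (H2 ltac:(lia)); lra.
Qed.

#[global] Arguments Cnorm : simpl never.
#[global] Arguments Cadd : simpl never.
#[global] Arguments Csub : simpl never.
#[global] Arguments Cmul : simpl never.
#[global] Arguments Copp : simpl never.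
#[global] Arguments Cinv : simpl never.
#[global] Arguments Cdiv : simpl never.

Ltac C_coords := apply C_eq; unfold Csub, Cadd, Cmul, Copp, RtoC, C1, C0; simpl.

Lemma Cnorm_mul_sub_le (a b a' b' : C) (eta A B : R) :
  Cnorm (a - a')%K <= eta -> Cnorm (b - b')%K <= eta -> eta <= 1 ->
  Cnorm a <= A -> Cnorm b <= B -> Cnorm (a * b - a' * b')%K <= eta * (A + B + 1).
Proof.
  intros H1 H2 H3 HA HB.
  replace (a * b - a' * b')%K with
    ((a - a') * b + (a * (b - b') - (a - a') * (b - b')))%K by ring.
  eapply Rle_trans; [apply Cnorm_add|].
  eapply Rle_trans; [apply Rplus_le_compat_l, Cnorm_sub|]; rewrite !Cnorm_mul.
  pose proof (Cnorm_ge0 (a - a')%K); pose proof (Cnorm_ge0 (b - b')%K).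
  pose proof (Cnorm_ge0 a); pose proof (Cnorm_ge0 b).
  assert (Cnorm (a - a')%K * Cnorm b <= eta * B) by (apply Rmult_le_compat; lra).
  assert (Cnorm a * Cnorm (b - b')%K <= A * eta) by (apply Rmult_le_compat; lra).
  assert (Cnorm (a - a')%K * Cnorm (b - b')%K <= eta * 1) by (apply Rmult_le_compat; lra).
  lra.
Qed.

Lemma sumsq_ge_term (n k : nat) (f : nat -> R) : (k < n)%nat -> f k * f k <= sumsq n f.
Proof.
  induction n as [|n IH]; intro h; [lia|]; simpl.
  assert (P : forall l, 0 <= sumsq l f) by (induction l; simpl; nra).
  destruct (Nat.eq_dec k n) as [->|hn]; [specialize (P n); lra|].
  specialize (IH ltac:(lia)); nra.
Qed.

Lemma coord_le_dist (M k : nat) (v w : Vec) : (k < M)%nat ->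
  Cnorm (v k - w k)%K <= dist M v w.
Proof.
  intro h; unfold dist.
  rewrite <- (sqrt_Rsqr (Cnorm (v k - w k)%K)) by apply Cnorm_ge0.
  apply sqrt_le_1_alt; exact (sumsq_ge_term M k (fun j => Cnorm (v j - w j)%K) h).
Qed.

(** The factor [INR M + 1] is cruder than the square root of [M] but positive even for [M = 0], so
    it can be divided by. *)
Lemma dist_le_coord (M : nat) (v w : Vec) (e : R) : 0 <= e ->
  (forall k, (k < M)%nat -> Cnorm (v k - w k)%K <= e) -> dist M v w <= (INR M + 1) * e.
Proof.
  intros He H; pose proof (pos_INR M) as HM; unfold dist.
  rewrite <- (sqrt_Rsqr ((INR M + 1) * e)) by nra; apply sqrt_le_1_alt.
  apply Rle_trans with (INR M * (e * e)); [|unfold Rsqr; nra].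
  induction M as [|M IH]; [simpl; lra|]; rewrite S_INR.
  cbn [sumsq]; pose proof (H M ltac:(lia)) as HMM.
  pose proof (Cnorm_ge0 (v M - w M)%K).
  assert (sumsq M (fun k => Cnorm (v k - w k)%K) <= INR M * (e * e))
    by (apply IH; auto using pos_INR).
  nra.
Qed.

(** * Polynomials and uniform approximation *)

Lemma polyD (M : nat) (p q : Vec -> C) :
  is_poly M p -> is_poly M q -> is_poly M (fun v => p v + q v)%K.
Proof. apply poly_add. Qed.

Lemma polyM (M : nat) (p q : Vec -> C) :
  is_poly M p -> is_poly M q -> is_poly M (fun v => p v * q v)%K.
Proof. apply poly_mul. Qed.

Lemma polyB (M : nat) (p q : Vec -> C) :
  is_poly M p -> is_poly M q -> is_poly M (fun v => p v - q v)%K.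
Proof.
  intros Hp Hq.
  replace (fun v => p v - q v)%K with (fun v => p v + (- C1) * q v)%K
    by (apply functional_extensionality; intro; ring).
  auto using polyD, polyM, poly_const.
Qed.

Lemma polyX (M : nat) (p : Vec -> C) (n : nat) :
  is_poly M p -> is_poly M (fun v => Cpow (p v) n).
Proof. intro Hp; induction n; simpl; auto using poly_const, polyM. Qed.

Lemma poly_weaken (N M : nat) (p : Vec -> C) : (N <= M)%nat -> is_poly N p -> is_poly M p.
Proof.
  intros h H; induction H.
  - apply poly_const.
  - apply poly_coord; lia.
  - now apply poly_add.
  - now apply poly_mul.
Qed.

Lemma poly_ext (M : nat) (p : Vec -> C) (v w : Vec) :
  is_poly M p -> (forall k, (k < M)%nat -> v k = w k) -> p v = p w.
Proof.
  intros H E; induction H; unfold fadd, fmul; auto.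
  - now rewrite IHis_poly1, IHis_poly2.
  - now rewrite IHis_poly1, IHis_poly2.
Qed.

Definition in_polydisc (M : nat) (r : R) (v : Vec) : Prop :=
  forall k, (k < M)%nat -> Cnorm (v k) <= r.

Lemma poly_bounded (M : nat) (p : Vec -> C) (r : R) : is_poly M p ->
  exists B, 0 <= B /\ forall v, in_polydisc M r v -> Cnorm (p v) <= B.
Proof.
  induction 1 as [c|k Hk|p q _ [B [HB Hp]] _ [B' [HB' Hq]]|p q _ [B [HB Hp]] _ [B' [HB' Hq]]].
  - exists (Cnorm c); split; [apply Cnorm_ge0|]; intros; lra.
  - exists (Rabs r); split; [apply Rabs_pos|]; intros v Hv.
    eapply Rle_trans; [now apply Hv|apply Rle_abs].
  - exists (B + B'); split; [lra|]; intros v Hv; unfold fadd.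
    eapply Rle_trans; [apply Cnorm_add|]; specialize (Hp v Hv); specialize (Hq v Hv); lra.
  - exists (B * B'); split; [nra|]; intros v Hv; unfold fmul; rewrite Cnorm_mul.
    apply Rmult_le_compat; auto using Cnorm_ge0.
Qed.

(* Newton's iteration for [Cinv z]: it squares the defect [1 - b * z]. *)
Fixpoint newton_inv (z : C) (n : nat) : C :=
  match n with
  | O => C1
  | S m => (newton_inv z m * (C1 + (C1 - newton_inv z m * z)))%K
  end.

(* Newton's iteration for an inverse square root: with [z = rho^2] and
   [beta = b * rho], the defect [1 - beta] becomes [(1 - beta)^2 (2 + beta) / 2]. *)
Fixpoint newton_isqrt (z : C) (n : nat) : C :=
  match n with
  | O => C1
  | S m => (newton_isqrt z m *
            (C1 + RtoC (1 / 2) * (C1 - newton_isqrt z m * newton_isqrt z m * z)))%K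
  end.

(** [approx M D g phi]: [phi] is a uniform limit on [D] of polynomials in the
    coordinates of [g]; thus [inP M X] is [approx M X id].  Index sets more
    general than subsets of [Vec] carry the auxiliary square roots that are not
    yet known to be functions of the point. *)
Definition approx {I : Type} (M : nat) (D : I -> Prop) (g : I -> Vec) (phi : I -> C) :=
  forall eps, 0 < eps -> exists p, is_poly M p /\
    forall i, D i -> Cnorm (phi i - p (g i))%K <= eps.

Section Approx.
Variables (I : Type) (M : nat) (D : I -> Prop) (g : I -> Vec) (r : R).
Hypothesis g_bounded : forall i, D i -> in_polydisc M r (g i).

Local Notation apx := (approx M D g).

Lemma approx_bounded phi : apx phi ->
  exists B, 0 < B /\ forall i, D i -> Cnorm (phi i) <= B.
Proof.
  intro H; destruct (H 1) as [p [Hp Ha]]; [lra|].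
  destruct (poly_bounded M p r Hp) as [B [HB Hb]].
  exists (B + 1); split; [lra|]; intros i Hi.
  eapply Rle_trans; [apply Cnorm_le_add with (b := p (g i))|].
  specialize (Ha i Hi); specialize (Hb _ (g_bounded i Hi)); lra.
Qed.

Lemma approx_poly p : is_poly M p -> apx (fun i => p (g i)).
Proof.
  intros Hp eps He; exists p; split; auto; intros i _.
  replace (p (g i) - p (g i))%K with C0 by ring; rewrite Cnorm_0; lra.
Qed.

Lemma approx_const c : apx (fun _ => c).
Proof. apply (approx_poly (fun _ => c)), poly_const. Qed.

Lemma approx_eq phi psi : (forall i, D i -> phi i = psi i) -> apx phi -> apx psi.
Proof.
  intros E H eps He; destruct (H eps He) as [p [Hp Ha]]; exists p; split; auto.
  intros i Hi; rewrite <- E; auto.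
Qed.

Lemma approx_lim phi :
  (forall eps, 0 < eps -> exists psi, apx psi /\
    forall i, D i -> Cnorm (phi i - psi i)%K <= eps) -> apx phi.
Proof.
  intros H eps He; destruct (H (eps / 2)) as [psi [Hpsi Hc]]; [lra|].
  destruct (Hpsi (eps / 2)) as [p [Hp Ha]]; [lra|].
  exists p; split; auto; intros i Hi.
  eapply Rle_trans; [apply Cnorm_tri with (b := psi i)|].
  specialize (Hc i Hi); specialize (Ha i Hi); lra.
Qed.

Lemma approx_add phi psi : apx phi -> apx psi -> apx (fun i => phi i + psi i)%K.
Proof.
  intros H1 H2 eps He; destruct (H1 (eps / 2)) as [p [Hp Ha]]; [lra|].
  destruct (H2 (eps / 2)) as [q [Hq Hb]]; [lra|].
  exists (fun v => p v + q v)%K; split; [now apply polyD|]; intros i Hi.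
  replace (phi i + psi i - (p (g i) + q (g i)))%K with
    ((phi i - p (g i)) + (psi i - q (g i)))%K by ring.
  eapply Rle_trans; [apply Cnorm_add|].
  specialize (Ha i Hi); specialize (Hb i Hi); lra.
Qed.

Lemma approx_mul phi psi : apx phi -> apx psi -> apx (fun i => phi i * psi i)%K.
Proof.
  intros H1 H2 eps He.
  destruct (approx_bounded psi H2) as [B [HB Hb]].
  destruct (H1 (eps / (2 * B))) as [p [Hp Ha]]; [apply Rdiv_lt_0_compat; lra|].
  destruct (poly_bounded M p r Hp) as [B' [HB' Hb']].
  (* The tolerance for [psi] depends on a bound for [p], so [q] is chosen after [p]. *)
  destruct (H2 (eps / (2 * (B' + 1)))) as [q [Hq Hc]]; [apply Rdiv_lt_0_compat; lra|].
  exists (fun v => p v * q v)%K; split; [now apply polyM|]; intros i Hi.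
  replace (phi i * psi i - p (g i) * q (g i))%K with
    ((phi i - p (g i)) * psi i + p (g i) * (psi i - q (g i)))%K by ring.
  eapply Rle_trans; [apply Cnorm_add|]; rewrite !Cnorm_mul.
  assert (Cnorm (phi i - p (g i))%K * Cnorm (psi i) <= eps / (2 * B) * B)
    by (apply Rmult_le_compat; auto using Cnorm_ge0).
  assert (Cnorm (p (g i)) * Cnorm (psi i - q (g i))%K <=
          (B' + 1) * (eps / (2 * (B' + 1)))).
  { apply Rmult_le_compat; auto using Cnorm_ge0.
    specialize (Hb' _ (g_bounded i Hi)); lra. }
  replace eps with (eps / (2 * B) * B + (B' + 1) * (eps / (2 * (B' + 1))))
    by (field; lra).
  lra.
Qed.

Lemma approx_sub phi psi : apx phi -> apx psi -> apx (fun i => phi i - psi i)%K.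
Proof.
  intros H1 H2; apply approx_eq with (fun i => phi i + (- C1) * psi i)%K.
  - intros; ring.
  - auto using approx_add, approx_mul, approx_const.
Qed.

Lemma approx_poly_comp (L : nat) (u : Vec -> C) (x : I -> Vec) : is_poly L u ->
  (forall k, (k < L)%nat -> apx (fun i => x i k)) -> apx (fun i => u (x i)).
Proof.
  intros Hu Hx; induction Hu; auto using approx_const.
  - now apply approx_add.
  - now apply approx_mul.
Qed.

(** Change of generators: once the coordinates of [x] lie in the algebra generated by [g], so does
    every function of [inP L H] evaluated at [x]. This transports functions of an earlier stage to
    later ones. *)
Lemma approx_inP_comp (L : nat) (H : Vec -> Prop) (f : Vec -> C) (x : I -> Vec) :
  inP L H f -> (forall i, D i -> H (x i)) ->
  (forall k, (k < L)%nat -> apx (fun i => x i k)) -> apx (fun i => f (x i)).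
Proof.
  intros Hf HD Hx; apply approx_lim; intros eps He.
  destruct (Hf eps He) as [p [Hp Ha]]; exists (fun i => p (x i)); split.
  - now apply approx_poly_comp with L.
  - intros i Hi; now apply Ha, HD.
Qed.

Lemma approx_geometric (phi : I -> C) (b : nat -> I -> C) (K : R) :
  0 < K -> (forall n, apx (b n)) ->
  (forall n i, D i -> Cnorm (phi i - b n i)%K <= K * (1 / 2) ^ n) -> apx phi.
Proof.
  intros HK Hb Hc; apply approx_lim; intros eps He.
  destruct (pow_half_small (eps / K)) as [n Hn]; [apply Rdiv_lt_0_compat; lra|].
  exists (b n); split; auto; intros i Hi; eapply Rle_trans; [now apply Hc|].
  specialize (Hn n (le_n _)).
  replace eps with (K * (eps / K)) by (field; lra); apply Rmult_le_compat_l; lra.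
Qed.

Lemma approx_inv_near_1 phi : apx phi ->
  (forall i, D i -> Cnorm (C1 - phi i)%K <= 1 / 2) -> apx (fun i => Cinv (phi i)).
Proof.
  intros H1 H2.
  apply approx_geometric with (fun n i => newton_inv (phi i) n) 2; [lra| |].
  - induction n; simpl; [apply approx_const|].
    repeat (assumption || apply approx_const || apply approx_mul || apply approx_sub
            || apply approx_add).
  - intros n i Hi; specialize (H2 i Hi).
    assert (Hn : 1 / 2 <= Cnorm (phi i)).
    { pose proof (Cnorm_le_add C1 (phi i)) as Q; rewrite Cnorm_1 in Q; lra. }
    assert (Hnz : phi i <> C0) by (apply Cnorm_neq0; lra).
    (* Squaring at least halves a defect that is at most 1/2; this linear rate suffices. *)
    assert (Hd : Cnorm (C1 - newton_inv (phi i) n * phi i)%K <= (1 / 2) * (1 / 2) ^ n).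
    { induction n; simpl.
      - replace (C1 - C1 * phi i)%K with (C1 - phi i)%K by ring; lra.
      - replace (C1 - newton_inv (phi i) n *
                   (C1 + (C1 - newton_inv (phi i) n * phi i)) * phi i)%K with
          ((C1 - newton_inv (phi i) n * phi i) * (C1 - newton_inv (phi i) n * phi i))%K by ring.
        rewrite Cnorm_mul; pose proof (Cnorm_ge0 (C1 - newton_inv (phi i) n * phi i)%K).
        pose proof (pow_half_le_1 n).
        nra. }
    replace (Cinv (phi i) - newton_inv (phi i) n)%K with
      (Cinv (phi i) * (C1 - newton_inv (phi i) n * phi i))%K by (field; auto).
    rewrite Cnorm_mul, Cnorm_inv by auto.
    assert (/ Cnorm (phi i) <= 2).
    { replace 2 with (/ (1 / 2)) by field; apply Rinv_le_contravar; lra. }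
    pose proof (Cnorm_ge0 (C1 - newton_inv (phi i) n * phi i)%K).
    pose proof (pow_le (1 / 2) n ltac:(lra)); nra.
Qed.

(** [phi * chi] is within 1/2 of 1, hence invertible, and [1 / phi = chi / (phi * chi)]. An
    approximate inverse thus yields an exact one. *)
Lemma approx_inv phi chi : apx phi -> apx chi ->
  (forall i, D i -> Cnorm (phi i * chi i - C1)%K <= 1 / 2) ->
  (forall i, D i -> phi i <> C0) /\ apx (fun i => Cinv (phi i)).
Proof.
  intros H1 H2 H3.
  assert (Hnz : forall i, D i -> (phi i * chi i)%K <> C0).
  { intros i Hi E; specialize (H3 i Hi); rewrite E in H3.
    replace (C0 - C1)%K with (- C1)%K in H3 by ring.
    rewrite Cnorm_opp, Cnorm_1 in H3; lra. }
  assert (Hp : forall i, D i -> phi i <> C0).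
  { intros i Hi E; apply (Hnz i Hi); rewrite E; ring. }
  split; auto.
  apply approx_eq with (fun i => chi i * Cinv (phi i * chi i))%K.
  - intros i Hi; field; split; auto; intro E; apply (Hnz i Hi); rewrite E; ring.
  - apply approx_mul; auto; apply approx_inv_near_1; [now apply approx_mul|].
    intros i Hi; rewrite Cnorm_subC; auto.
Qed.

(** Only the square of [rho] is assumed to be in the algebra. The iteration uses nothing but
    [rho * rho], and its starting value 1 makes it converge to the inverse of the root near 1. *)
Lemma approx_inv_of_sqr rho : apx (fun i => rho i * rho i)%K ->
  (forall i, D i -> Cnorm (C1 - rho i)%K <= 1 / 8) -> apx (fun i => Cinv (rho i)).
Proof.
  intros H1 H2.
  apply approx_geometric with (fun n i => newton_isqrt (rho i * rho i)%K n) 2; [lra| |].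
  - induction n; simpl; [apply approx_const|].
    repeat (assumption || apply approx_const || apply approx_mul || apply approx_sub
            || apply approx_add).
  - intros n i Hi; specialize (H2 i Hi).
    assert (Hn : 1 / 2 <= Cnorm (rho i)).
    { pose proof (Cnorm_le_add C1 (rho i)) as Q; rewrite Cnorm_1 in Q; lra. }
    assert (Hnz : rho i <> C0) by (apply Cnorm_neq0; lra).
    assert (Hd : Cnorm (C1 - newton_isqrt (rho i * rho i)%K n * rho i)%K
                 <= (1 / 8) * (1 / 2) ^ n).
    { induction n; simpl.
      - replace (C1 - C1 * rho i)%K with (C1 - rho i)%K by ring; lra.
      - set (e := (C1 - newton_isqrt (rho i * rho i)%K n * rho i)%K) in *.
        (* In terms of the old defect [e] the new one is [e^2 (3 - e) / 2]; for [|e| <= 1/8] its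
           modulus is at most half of [|e|]. *)
        replace (C1 - newton_isqrt (rho i * rho i)%K n * (C1 + RtoC (1 / 2) *
                  (C1 - newton_isqrt (rho i * rho i)%K n * newton_isqrt (rho i * rho i)%K n
                   * (rho i * rho i))) * rho i)%K with
          (e * (e * (RtoC (3 / 2) - RtoC (1 / 2) * e)))%K
          by (unfold e; generalize (newton_isqrt (rho i * rho i)%K n); intros [? ?];
              destruct (rho i); C_coords; field).
        rewrite !Cnorm_mul; pose proof (Cnorm_ge0 e).
        pose proof (pow_half_le_1 n).
        assert (Cnorm (RtoC (3 / 2) - RtoC (1 / 2) * e)%K <= 2).
        { eapply Rle_trans; [apply Cnorm_sub|]; rewrite Cnorm_mul, !Cnorm_RtoC.
          rewrite !Rabs_pos_eq by lra; lra. }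
        pose proof (Cnorm_ge0 (RtoC (3 / 2) - RtoC (1 / 2) * e)%K).
        assert (Cnorm e * Cnorm (RtoC (3 / 2) - RtoC (1 / 2) * e)%K <= 1 / 2) by nra.
        nra. }
    replace (Cinv (rho i) - newton_isqrt (rho i * rho i)%K n)%K with
      (Cinv (rho i) * (C1 - newton_isqrt (rho i * rho i)%K n * rho i))%K by (field; auto).
    rewrite Cnorm_mul, Cnorm_inv by auto.
    assert (/ Cnorm (rho i) <= 2).
    { replace 2 with (/ (1 / 2)) by field; apply Rinv_le_contravar; lra. }
    pose proof (Cnorm_ge0 (C1 - newton_isqrt (rho i * rho i)%K n * rho i)%K).
    pose proof (pow_le (1 / 2) n ltac:(lra)); nra.
Qed.

End Approx.

(** * Dense invertibles at the level of polynomials *)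

(** Only sup-norm inequalities between polynomials occur, so the property passes to dominated sets.
    A defect of 1/2 is small enough for [approx_inv] to produce a true inverse. *)
Definition poly_dense_invertibles (M : nat) (H : Vec -> Prop) : Prop :=
  forall p, is_poly M p -> forall eps, 0 < eps -> exists q s,
    is_poly M q /\ is_poly M s /\
    (forall x, H x -> Cnorm (p x - q x)%K <= eps) /\
    (forall x, H x -> Cnorm (q x * s x - C1)%K <= 1 / 2).

Lemma approx_invertible_poly {I : Type} (M : nat) (D : I -> Prop) (g : I -> Vec) (r : R)
  (phi chi : I -> C) (eps : R) :
  (forall i, D i -> in_polydisc M r (g i)) ->
  approx M D g phi -> approx M D g chi ->
  (forall i, D i -> (phi i * chi i)%K = C1) -> 0 < eps ->
  exists q s, is_poly M q /\ is_poly M s /\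
    (forall i, D i -> Cnorm (phi i - q (g i))%K <= eps) /\
    (forall i, D i -> Cnorm (q (g i) * s (g i) - C1)%K <= 1 / 2).
Proof.
  intros Hg H1 H2 H3 He.
  destruct (approx_bounded I M D g r Hg phi H1) as [B [HB Hb]].
  destruct (approx_bounded I M D g r Hg chi H2) as [B' [HB' Hb']].
  (* The error of the product splits into one quadratic and two linear terms; as [eta <= 1], they
     add up to at most [eta * (B + B' + 1)], which has to be at most 1/2. *)
  set (eta := Rmin (Rmin eps 1) (/ (2 * (B + B' + 1)))).
  assert (He1 : eta <= eps) by (unfold eta; eapply Rle_trans; [apply Rmin_l|apply Rmin_l]).
  assert (He2 : eta <= 1) by (unfold eta; eapply Rle_trans; [apply Rmin_l|apply Rmin_r]).
  assert (He3 : eta <= / (2 * (B + B' + 1))) by (unfold eta; apply Rmin_r).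
  assert (He4 : eta * (B + B' + 1) <= 1 / 2).
  { replace (1 / 2) with (/ (2 * (B + B' + 1)) * (B + B' + 1)) by (field; lra).
    apply Rmult_le_compat_r; lra. }
  assert (0 < eta).
  { unfold eta; repeat apply Rmin_glb_lt; try lra; apply Rinv_0_lt_compat; lra. }
  destruct (H1 eta) as [q [Hq Hqa]]; auto.
  destruct (H2 eta) as [s [Hs Hsa]]; auto.
  exists q, s; split; [|split; [|split]]; auto.
  - intros i Hi; specialize (Hqa i Hi); lra.
  - intros i Hi; rewrite <- (H3 i Hi).
    replace (q (g i) * s (g i) - phi i * chi i)%K with
      ((s (g i) - chi i) * (q (g i) - phi i) + ((s (g i) - chi i) * phi i
        + (q (g i) - phi i) * chi i))%K by ring.
    specialize (Hqa i Hi); specialize (Hsa i Hi); specialize (Hb i Hi); specialize (Hb' i Hi).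
    rewrite Cnorm_subC in Hqa, Hsa.
    pose proof (Cnorm_ge0 (q (g i) - phi i)%K); pose proof (Cnorm_ge0 (s (g i) - chi i)%K).
    pose proof (Cnorm_ge0 (phi i)); pose proof (Cnorm_ge0 (chi i)).
    eapply Rle_trans; [apply Cnorm_add|].
    eapply Rle_trans; [apply Rplus_le_compat_l, Cnorm_add|]; rewrite !Cnorm_mul.
    assert (Cnorm (s (g i) - chi i)%K * Cnorm (q (g i) - phi i)%K <= eta * 1)
      by (apply Rmult_le_compat; lra).
    assert (Cnorm (s (g i) - chi i)%K * Cnorm (phi i) <= eta * B)
      by (apply Rmult_le_compat; lra).
    assert (Cnorm (q (g i) - phi i)%K * Cnorm (chi i) <= eta * B')
      by (apply Rmult_le_compat; lra).
    nra.
Qed.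

Lemma dense_invertibles_poly (M : nat) (X : Vec -> Prop) (r : R) :
  (forall x, X x -> in_polydisc M r x) ->
  dense_invertibles M X -> poly_dense_invertibles M X.
Proof.
  intros Hr H p Hp eps He.
  destruct (H p) with (eps := eps / 2) as [f [Hf [[h [Hh E]] Hc]]]; [|lra|].
  { apply (approx_poly Vec M X (fun x => x) p Hp). }
  destruct (approx_invertible_poly M X (fun x => x) r f h (eps / 2))
    as [q [s [Hq [Hs [Ha Hb]]]]]; auto; [lra|].
  exists q, s; split; [|split; [|split]]; auto; intros x Hx.
  eapply Rle_trans; [apply Cnorm_tri with (b := f x)|].
  specialize (Ha x Hx); specialize (Hc x Hx); unfold fsub in Hc; lra.
Qed.

Lemma poly_dense_invertibles_inP (M : nat) (X : Vec -> Prop) (r : R) (f : Vec -> C) (eps : R) :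
  (forall x, X x -> in_polydisc M r x) ->
  poly_dense_invertibles M X -> inP M X f -> 0 < eps ->
  exists q, inP M X q /\ (forall x, X x -> q x <> C0) /\
    inP M X (fun x => Cinv (q x)) /\ forall x, X x -> Cnorm (f x - q x)%K <= eps.
Proof.
  intros Hr H Hf He; destruct (Hf (eps / 2)) as [p [Hp Ha]]; [lra|].
  destruct (H p Hp (eps / 2)) as [q [s [Hq [Hs [Hc Hd]]]]]; [lra|].
  pose proof (approx_poly Vec M X (fun x => x) q Hq) as Hq'.
  pose proof (approx_poly Vec M X (fun x => x) s Hs) as Hs'.
  destruct (approx_inv Vec M X (fun x => x) r Hr q s Hq' Hs' Hd) as [Hn Hi].
  exists q; split; [|split; [|split]]; auto.
  intros x Hx; eapply Rle_trans; [apply Cnorm_tri with (b := p x)|].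
  specialize (Ha x Hx); specialize (Hc x Hx); unfold fsub in Ha; lra.
Qed.

Lemma poly_dense_invertibles_dense (M : nat) (X : Vec -> Prop) (r : R) :
  (forall x, X x -> in_polydisc M r x) ->
  poly_dense_invertibles M X -> dense_invertibles M X.
Proof.
  intros Hr H f Hf eps He.
  destruct (poly_dense_invertibles_inP M X r f eps) as [q [Hq [Hn [Hi Hc]]]]; auto.
  exists q; split; [|split]; auto.
  exists (fun x => Cinv (q x)); split; auto; intros x Hx; apply Cinv_r; auto.
Qed.

(** [H] lies in the polynomial hull of [S], apart from the vanishing of the coordinates beyond
    [M]. *)
Definition dominates (M : nat) (S H : Vec -> Prop) : Prop :=
  forall p, is_poly M p -> forall B, bounded_by S p B -> bounded_by H p B.

Lemma poly_dense_invertibles_dominates (M : nat) (S H : Vec -> Prop) :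
  dominates M S H -> poly_dense_invertibles M S -> poly_dense_invertibles M H.
Proof.
  intros HD HS p Hp eps He; destruct (HS p Hp eps He) as [q [s [Hq [Hs [Ha Hb]]]]].
  exists q, s; split; [|split; [|split]]; auto.
  - apply (HD (fun x => p x - q x)%K); auto using polyB.
  - apply (HD (fun x => q x * s x - C1)%K); auto using polyB, polyM, poly_const.
Qed.

(** * Adjoining a square root in the last coordinate *)

Definition shift (N : nat) (x : Vec) (t : C) : Vec :=
  fun k => if Nat.eqb k N then (x k + t)%K else x k.

(** Both roots are adjoined at once, so no branch of the square root is chosen. *)
Definition step (N : nat) (E : Vec -> C) (H : Vec -> Prop) (v : Vec) : Prop :=
  exists x d, H x /\ (d * d)%K = E x /\ v = shift N x d.

(** The last coordinate of [x] in [H] can be recovered, by polynomials, from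
    perturbations of [x] of size at most [delta] in that coordinate. *)
Definition retract (N : nat) (H : Vec -> Prop) (delta : R) : Prop :=
  approx (S N) (fun i : Vec * C => H (fst i) /\ Cnorm (snd i) <= delta)
    (fun i => shift N (fst i) (snd i)) (fun i => fst i N).

Lemma shift_last (N : nat) (x : Vec) (t : C) : shift N x t N = (x N + t)%K.
Proof. unfold shift; now rewrite Nat.eqb_refl. Qed.

Lemma shift_other (N : nat) (x : Vec) (t : C) (k : nat) : k <> N -> shift N x t k = x k.
Proof. intro h; unfold shift; now rewrite (proj2 (Nat.eqb_neq k N) h). Qed.

Lemma shift_shift (N : nat) (x : Vec) (s t : C) :
  shift N (shift N x s) t = shift N x (s + t)%K.
Proof.
  apply functional_extensionality; intro k; unfold shift.
  destruct (Nat.eqb k N); auto; ring.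
Qed.

Lemma shift_polydisc (N : nat) (x : Vec) (t : C) (r delta : R) :
  in_polydisc (S N) r x -> Cnorm t <= delta -> in_polydisc (S N) (r + delta) (shift N x t).
Proof.
  intros Hx Ht k Hk; pose proof (Cnorm_ge0 t); specialize (Hx k Hk).
  unfold shift; destruct (Nat.eqb k N); [|lra].
  eapply Rle_trans; [apply Cnorm_add|]; lra.
Qed.

(** The polynomial given by [retract] serves all pairs of a point and a perturbation at once, hence
    any family [g] of perturbed points. Coordinates other than [N] are not perturbed at all. *)
Lemma retract_coord {I : Type} (N : nat) (H : Vec -> Prop) (delta : R) (D : I -> Prop)
  (g x : I -> Vec) :
  retract N H delta ->
  (forall i, D i -> H (x i) /\ exists t, Cnorm t <= delta /\ g i = shift N (x i) t) ->
  forall k, (k < S N)%nat -> approx (S N) D g (fun i => x i k).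
Proof.
  intros HR HD k Hk; destruct (Nat.eq_dec k N) as [->|Hn].
  - intros eps He; destruct (HR eps He) as [p [Hp Ha]]; exists p; split; auto.
    intros i Hi; destruct (HD i Hi) as [Hx [t [Ht ->]]]; apply (Ha (x i, t)); auto.
  - apply approx_eq with (fun i => g i k).
    + intros i Hi; destruct (HD i Hi) as [Hx [t [Ht ->]]]; now apply shift_other.
    + apply (approx_poly I (S N) D g (fun v => v k)); now apply poly_coord.
Qed.

Lemma Cnorm_sqrt_le (d e : C) (a : R) :
  (d * d)%K = e -> 0 <= a -> Cnorm e <= a * a -> Cnorm d <= a.
Proof.
  intros <- Ha; rewrite Cnorm_mul; intro h; pose proof (Cnorm_ge0 d).
  apply Rnot_lt_le; intro; nra.
Qed.

Lemma Cnorm_sqrt_ge (d e : C) (a : R) :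
  (d * d)%K = e -> 0 <= a -> a * a <= Cnorm e -> a <= Cnorm d.
Proof.
  intros <- Ha; rewrite Cnorm_mul; intro h; pose proof (Cnorm_ge0 d).
  apply Rnot_lt_le; intro; nra.
Qed.

(** Reduction modulo [d^2 = E]. The coefficients [a] and [b] are the same for both roots, so [d] and
    [-d] give conjugate values. *)
Lemma poly_shift_even_odd (N : nat) (E p : Vec -> C) :
  is_poly (S N) E -> is_poly (S N) p ->
  exists a b, is_poly (S N) a /\ is_poly (S N) b /\
    forall x d, (d * d)%K = E x -> p (shift N x d) = (a x + b x * d)%K.
Proof.
  intros HE; induction 1 as [c|k Hk|p q _ [a [b [Ha [Hb Hp]]]] _ [a' [b' [Ha' [Hb' Hq]]]]
                            |p q _ [a [b [Ha [Hb Hp]]]] _ [a' [b' [Ha' [Hb' Hq]]]]].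
  - exists (fun _ => c), (fun _ => C0); split; [|split]; try apply poly_const.
    intros; ring.
  - destruct (Nat.eq_dec k N) as [->|Hn].
    + exists (fun v => v N), (fun _ => C1); split; [|split].
      * now apply poly_coord.
      * apply poly_const.
      * intros; rewrite shift_last; ring.
    + exists (fun v => v k), (fun _ => C0); split; [|split].
      * now apply poly_coord.
      * apply poly_const.
      * intros; rewrite shift_other by auto; ring.
  - exists (fun x => a x + a' x)%K, (fun x => b x + b' x)%K; split; [|split];
      auto using polyD.
    intros x d h; unfold fadd; rewrite (Hp x d h), (Hq x d h); ring.
  - exists (fun x => a x * a' x + b x * b' x * E x)%K,
      (fun x => a x * b' x + b x * a' x)%K; split; [|split]; auto using polyD, polyM.
    intros x d h; unfold fmul; rewrite (Hp x d h), (Hq x d h), <- h; ring.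
Qed.

(** A perturbed point is [x + (d + t) e_N]. Since [|d + t| <= delta], the old retraction yields [x],
    hence also [d + t] and [E x = d^2]. Then [rho = (d + t) / d] is the root near 1 of the known
    function [(d + t)^2 / E], and the last coordinate of the new stage is
    [x_N + d = x_N + (d + t) / rho]. *)
Lemma step_retract (N : nat) (H : Vec -> Prop) (r delta : R) (E : Vec -> C) :
  (forall x, H x -> in_polydisc (S N) r x) -> 0 < delta -> retract N H delta ->
  is_poly (S N) E -> inP (S N) H (fun x => Cinv (E x)) ->
  (forall x, H x -> E x <> C0) ->
  (forall x, H x -> Cnorm (E x) <= (delta / 2) * (delta / 2)) ->
  exists m, 0 < m /\ (forall x, H x -> m * m <= Cnorm (E x)) /\
    forall delta', delta' <= m / 8 -> delta' <= delta / 2 -> retract N (step N E H) delta'.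
Proof.
  intros Hr Hd HR HE HI Hn Hs.
  destruct (approx_bounded _ _ _ _ r Hr _ HI) as [B [HB Hb]].
  (* [B] bounds [1 / |E|], so every root of [E x] has modulus at least [1 / sqrt B]. *)
  exists (/ sqrt B); pose proof (sqrt_lt_R0 B HB) as HsB; pose proof (sqrt_sqrt B) as HsB'.
  assert (Hm : forall x, H x -> / sqrt B * / sqrt B <= Cnorm (E x)).
  { intros x Hx; rewrite <- Rinv_mult, HsB' by lra.
    specialize (Hb x Hx); rewrite Cnorm_inv in Hb by auto.
    pose proof (Cnorm_gt0 _ (Hn x Hx)).
    rewrite <- (Rinv_inv (Cnorm (E x))); apply Rinv_le_contravar; auto.
    now apply Rinv_0_lt_compat. }
  assert (Hm0 : 0 < / sqrt B) by now apply Rinv_0_lt_compat.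
  split; [|split]; auto; intros delta' Hd1 Hd2.
  set (m := / sqrt B) in *.
  (* The root is part of the index because it is not yet known to be determined by the perturbed
     point. *)
  pose (D := fun i : Vec * C * C => H (fst (fst i)) /\
     (snd (fst i) * snd (fst i))%K = E (fst (fst i)) /\ Cnorm (snd i) <= delta').
  pose (g := fun i : Vec * C * C => shift N (fst (fst i)) (snd (fst i) + snd i)%K).
  assert (HdE : forall i, D i -> m <= Cnorm (snd (fst i)) <= delta / 2).
  { intros [[x d] t] [Hx [Hdd Ht]]; simpl in *; split.
    - apply Cnorm_sqrt_ge with (E x); auto; lra.
    - apply Cnorm_sqrt_le with (E x); auto; lra. }
  assert (HdD : forall i, D i -> Cnorm (snd (fst i) + snd i)%K <= delta).
  { intros i Hi; pose proof (HdE i Hi); destruct Hi as [_ [_ Ht]].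
    eapply Rle_trans; [apply Cnorm_add|]; lra. }
  assert (Hg : forall i, D i -> in_polydisc (S N) (r + delta) (g i)).
  { intros i Hi; apply shift_polydisc; auto; apply Hr, Hi. }
  assert (Hx : forall k, (k < S N)%nat -> approx (S N) D g (fun i => fst (fst i) k)).
  { apply retract_coord with H delta; auto.
    intros i Hi; split; [apply Hi|].
    exists (snd (fst i) + snd i)%K; split; [now apply HdD|reflexivity]. }
  pose proof (approx_inP_comp _ (S N) D g (r + delta) Hg (S N) H _
                (fun i => fst (fst i)) HI (fun i Hi => proj1 Hi) Hx) as HxI.
  assert (Hsg : approx (S N) D g (fun i => snd (fst i) + snd i)%K).
  { apply approx_eq with (fun i => g i N - fst (fst i) N)%K.
    - intros i Hi; unfold g; rewrite shift_last; ring.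
    - apply (approx_sub _ (S N) D g (r + delta) Hg); [|apply Hx; lia].
      apply (approx_poly _ (S N) D g (fun v => v N)), poly_coord; lia. }
  assert (Hnd : forall i, D i -> snd (fst i) <> C0).
  { intros i Hi; apply Cnorm_neq0; pose proof (HdE i Hi); lra. }
  assert (Hrho : approx (S N) D g
    (fun i => Cinv ((snd (fst i) + snd i) / snd (fst i)))%K).
  { apply (approx_inv_of_sqr _ (S N) D g (r + delta) Hg).
    - apply approx_eq with (fun i => (snd (fst i) + snd i) * (snd (fst i) + snd i)
        * Cinv (E (fst (fst i))))%K.
      + intros i Hi; destruct Hi as [Hi1 [Hi2 Hi3]] eqn:Ei; rewrite <- Hi2.
        field; now apply Hnd.
      + repeat apply (approx_mul _ (S N) D g (r + delta) Hg); auto.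
    - intros i Hi; pose proof (HdE i Hi); pose proof (Hnd i Hi).
      replace (C1 - (snd (fst i) + snd i) / snd (fst i))%K with
        (- (snd i * Cinv (snd (fst i))))%K by (field; auto).
      rewrite Cnorm_opp, Cnorm_mul, Cnorm_inv by auto.
      destruct Hi as [_ [_ Ht]]; pose proof (Cnorm_ge0 (snd i)).
      apply Rmult_le_reg_r with (Cnorm (snd (fst i))); [lra|].
      rewrite Rmult_assoc, Rinv_l by lra; lra. }
  assert (Hfin : approx (S N) D g (fun i => fst (fst i) N + snd (fst i))%K).
  { apply approx_add; [apply Hx; lia|].
    apply approx_eq with (fun i => (snd (fst i) + snd i) *
      Cinv ((snd (fst i) + snd i) / snd (fst i)))%K.
    - intros i Hi; field; split; [now apply Hnd|].
      apply Cnorm_neq0; pose proof (HdE i Hi).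
      pose proof (Cnorm_le_add (snd (fst i)) (snd (fst i) + snd i)%K) as Q.
      replace (snd (fst i) - (snd (fst i) + snd i))%K with (- snd i)%K in Q by ring.
      rewrite Cnorm_opp in Q; destruct Hi as [_ [_ Ht]]; lra.
    - now apply (approx_mul _ (S N) D g (r + delta) Hg). }
  intros eps He; destruct (Hfin eps He) as [p [Hp Ha]]; exists p; split; auto.
  intros [v t] [[x [d [Hx' [Hdd ->]]]] Ht]; simpl in *.
  specialize (Ha (x, d, t)); unfold D, g in Ha; simpl in Ha.
  rewrite shift_shift, shift_last; auto.
Qed.

(** Writing an element of the extension as [a + b d] with [d^2 = E], we make [b]
    invertible, then [c] close to [a / b] invertible, and finally move [c] so that
    [(c + d) (c - d) = c^2 - E] becomes a prescribed invertible element [u']: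
    near an invertible [c], the map [c |-> c^2] is open. *)
Lemma step_dense_invertibles (N : nat) (H : Vec -> Prop) (r delta : R) (E : Vec -> C) :
  (forall x, H x -> in_polydisc (S N) r x) -> 0 < delta -> retract N H delta ->
  is_poly (S N) E -> (forall x, H x -> Cnorm (E x) <= delta * delta) ->
  poly_dense_invertibles (S N) H -> poly_dense_invertibles (S N) (step N E H).
Proof.
  intros Hr Hdl HR HE Hs HDI p Hp eps He.
  destruct (poly_shift_even_odd N E p HE Hp) as [a [b [Ha [Hb Hab]]]].
  assert (Pi : forall q, is_poly (S N) q -> inP (S N) H q)
    by (intros q Hq; apply (approx_poly Vec (S N) H (fun x => x) q Hq)).
  (* The error in [b] gets multiplied by [d], and [|d| <= delta]; this costs [eps / 4]. *)
  destruct (poly_dense_invertibles_inP (S N) H r b (eps / (4 * delta)) Hr HDI (Pi _ Hb))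
    as [b' [Hb' [Hbn [Hbi Hbc]]]]; [apply Rdiv_lt_0_compat; lra|].
  destruct (approx_bounded _ _ _ _ r Hr _ Hb') as [B [HB HBb]].
  assert (Hal : inP (S N) H (fun x => a x * Cinv (b' x))%K)
    by (apply (approx_mul Vec (S N) H (fun x => x) r Hr); [now apply Pi|exact Hbi]).
  destruct (poly_dense_invertibles_inP (S N) H r _ (eps / (8 * B)) Hr HDI Hal)
    as [c [Hc [Hcn [Hci Hcc]]]]; [apply Rdiv_lt_0_compat; lra|].
  destruct (approx_bounded _ _ _ _ r Hr _ Hci) as [K [HK HKc]].
  assert (Hu : inP (S N) H (fun x => c x * c x - E x)%K).
  { apply (approx_sub Vec (S N) H (fun x => x) r Hr); [|now apply Pi].
    now apply (approx_mul Vec (S N) H (fun x => x) r Hr). }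
  (* The first bound keeps the corrected [c'] within [eps / (8 * B)] of [c]; the second keeps [z]
     within 1/8 of 1. *)
  set (e3 := Rmin (eps / (8 * B * K)) (/ (8 * K * K))).
  assert (He3 : 0 < e3).
  { apply Rmin_glb_lt; [apply Rdiv_lt_0_compat; nra|apply Rinv_0_lt_compat; nra]. }
  destruct (poly_dense_invertibles_inP (S N) H r _ e3 Hr HDI Hu)
    as [u [Hu' [Hun [Hui Huc]]]]; auto.
  (* [z] is the ratio of the wanted square [u + E] to [c^2]; multiplying [c] by the root of [z] near
     1 makes [c'^2 - E] equal to [u]. *)
  pose (z := fun x => ((u x + E x) * (Cinv (c x) * Cinv (c x)))%K).
  pose (c' := fun x => (c x * Csqrt (z x))%K).
  assert (Hz : forall x, H x -> Cnorm (C1 - z x)%K <= e3 * (K * K)).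
  { intros x Hx; specialize (Huc x Hx); specialize (HKc x Hx); specialize (Hcn x Hx).
    replace (C1 - z x)%K with ((c x * c x - E x - u x) * (Cinv (c x) * Cinv (c x)))%K
      by (unfold z; field; auto).
    rewrite !Cnorm_mul; pose proof (Cnorm_ge0 (Cinv (c x))).
    apply Rmult_le_compat; auto using Cnorm_ge0; nra. }
  assert (Hz8 : forall x, H x -> Cnorm (C1 - Csqrt (z x))%K <= 1 / 8).
  { intros x Hx; eapply Rle_trans; [apply Csqrt_near_1|].
    eapply Rle_trans; [now apply Hz|].
    replace (1 / 8) with (/ (8 * K * K) * (K * K)) by (field; lra).
    apply Rmult_le_compat_r; [nra|apply Rmin_r]. }
  assert (Hzn : forall x, H x -> Csqrt (z x) <> C0).
  { intros x Hx E0; specialize (Hz8 x Hx); rewrite E0 in Hz8.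
    replace (C1 - C0)%K with C1 in Hz8 by ring; rewrite Cnorm_1 in Hz8; lra. }
  assert (Hzi : inP (S N) H z).
  { apply (approx_mul Vec (S N) H (fun x => x) r Hr).
    - apply approx_add; [exact Hu'|now apply Pi].
    - now apply (approx_mul Vec (S N) H (fun x => x) r Hr). }
  assert (Hc' : inP (S N) H c').
  { apply (approx_mul Vec (S N) H (fun x => x) r Hr); auto.
    (* The iteration produces inverse roots, so the root itself is written as [z / Csqrt z]. *)
    apply approx_eq with (fun x => z x * Cinv (Csqrt (z x)))%K.
    - intros x Hx; rewrite <- (Csqrt_sqr (z x)) at 1; field; auto.
    - apply (approx_mul Vec (S N) H (fun x => x) r Hr); auto.
      apply (approx_inv_of_sqr Vec (S N) H (fun x => x) r Hr); auto.
      apply approx_eq with z; auto; intros; now rewrite Csqrt_sqr. }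
  assert (Hcsq : forall x, H x -> (c' x * c' x)%K = (u x + E x)%K).
  { intros x Hx; unfold c'.
    replace (c x * Csqrt (z x) * (c x * Csqrt (z x)))%K with
      (c x * c x * (Csqrt (z x) * Csqrt (z x)))%K by ring.
    rewrite Csqrt_sqr; unfold z; field; auto. }
  assert (Hcc' : forall x, H x -> Cnorm (c x - c' x)%K <= eps / (8 * B)).
  { intros x Hx.
    replace (c x - c' x)%K with (c x * (C1 - Csqrt (z x)))%K by (unfold c'; ring).
    rewrite Cnorm_mul.
    assert (Cnorm (C1 - Csqrt (z x))%K <= e3 * (K * / Cnorm (c x))).
    { eapply Rle_trans; [apply Csqrt_near_1|].
      replace (C1 - z x)%K with ((c x * c x - E x - u x) * (Cinv (c x) * Cinv (c x)))%K
        by (unfold z; field; auto).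
      specialize (Huc x Hx); specialize (HKc x Hx); specialize (Hcn x Hx).
      rewrite !Cnorm_mul; rewrite Cnorm_inv in * by auto.
      pose proof (Rinv_0_lt_compat _ (Cnorm_gt0 _ Hcn)).
      apply Rmult_le_compat; auto using Cnorm_ge0; nra. }
    assert (e3 * K <= eps / (8 * B)).
    { replace (eps / (8 * B)) with (eps / (8 * B * K) * K) by (field; lra).
      apply Rmult_le_compat_r; [lra|apply Rmin_l]. }
    pose proof (Cnorm_gt0 _ (Hcn x Hx)).
    eapply Rle_trans; [apply Rmult_le_compat_l; [lra|eassumption]|].
    replace (Cnorm (c x) * (e3 * (K * / Cnorm (c x)))) with (e3 * K) by (field; lra); auto. }
  pose (D := fun i : Vec * C => H (fst i) /\ (snd i * snd i)%K = E (fst i)).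
  pose (g := fun i : Vec * C => shift N (fst i) (snd i)).
  assert (HdD : forall i, D i -> Cnorm (snd i) <= delta).
  { intros [x d] [Hx Hdd]; simpl in *; apply Cnorm_sqrt_le with (E x); auto; lra. }
  assert (Hg : forall i, D i -> in_polydisc (S N) (r + delta) (g i)).
  { intros i Hi; apply shift_polydisc; auto; apply Hr, Hi. }
  assert (Hx : forall k, (k < S N)%nat -> approx (S N) D g (fun i => fst i k)).
  { apply retract_coord with H delta; auto.
    intros i Hi; split; [apply Hi|]; exists (snd i); split; auto. }
  assert (Pull : forall f, inP (S N) H f -> approx (S N) D g (fun i => f (fst i))).
  { intros f Hf; apply (approx_inP_comp _ (S N) D g (r + delta) Hg (S N) H f fst Hf); auto.
    intros i Hi; apply Hi. }
  assert (Hd : approx (S N) D g snd).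
  { apply approx_eq with (fun i => g i N - fst i N)%K.
    - intros i Hi; unfold g; rewrite shift_last; ring.
    - apply (approx_sub _ (S N) D g (r + delta) Hg); [|apply Hx; lia].
      apply (approx_poly _ (S N) D g (fun v => v N)), poly_coord; lia. }
  (* As [(c' + d) (c' - d) = u], the second function is the inverse of the first. *)
  destruct (approx_invertible_poly (S N) D g (r + delta)
    (fun i => b' (fst i) * (c' (fst i) + snd i))%K
    (fun i => Cinv (b' (fst i)) * ((c' (fst i) - snd i) * Cinv (u (fst i))))%K (eps / 4) Hg)
    as [q [s [Hq [Hs' [Hqa Hqs]]]]].
  - apply (approx_mul _ (S N) D g (r + delta) Hg); [now apply Pull|].
    apply approx_add; auto.
  - apply (approx_mul _ (S N) D g (r + delta) Hg); [now apply (Pull _ Hbi)|].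
    apply (approx_mul _ (S N) D g (r + delta) Hg); [|now apply (Pull _ Hui)].
    apply (approx_sub _ (S N) D g (r + delta) Hg); auto.
  - intros [x d] [Hx' Hdd]; simpl in *.
    replace (b' x * (c' x + d) * (Cinv (b' x) * ((c' x - d) * Cinv (u x))))%K with
      ((c' x * c' x - d * d) * Cinv (u x))%K by (field; auto).
    rewrite Hcsq, Hdd by auto; field; auto.
  - lra.
  - exists q, s; split; [|split; [|split]]; auto; intros v [x [d [Hx' [Hdd ->]]]].
    + eapply Rle_trans; [apply Cnorm_tri with (b := (b' x * (c' x + d))%K)|].
      assert (Di : D (x, d)) by (split; auto).
      specialize (Hqa (x, d) Di); specialize (HdD (x, d) Di); simpl in *.
      unfold g in Hqa; simpl in Hqa; rewrite (Hab x d Hdd).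
      replace (a x + b x * d - b' x * (c' x + d))%K with
        ((b x - b' x) * d + b' x * ((a x * Cinv (b' x) - c x) + (c x - c' x)))%K
        by (field; auto).
      assert (Q1 : Cnorm ((b x - b' x) * d)%K <= eps / (4 * delta) * delta)
        by (rewrite Cnorm_mul; apply Rmult_le_compat; auto using Cnorm_ge0).
      assert (Q2 : Cnorm (b' x * ((a x * Cinv (b' x) - c x) + (c x - c' x)))%K
              <= B * (eps / (8 * B) + eps / (8 * B))).
      { rewrite Cnorm_mul; apply Rmult_le_compat; auto using Cnorm_ge0.
        eapply Rle_trans; [apply Cnorm_add|]; apply Rplus_le_compat; auto. }
      replace (eps / (4 * delta) * delta) with (eps / 4) in Q1 by (field; lra).
      replace (B * (eps / (8 * B) + eps / (8 * B))) with (eps / 4) in Q2 by (field; lra).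
      pose proof (Cnorm_add ((b x - b' x) * d)
        (b' x * ((a x * Cinv (b' x) - c x) + (c x - c' x))))%K.
      lra.
    + apply (Hqs (x, d)); split; auto.
Qed.

(** For [p = a + b d] and its conjugate [p' = a - b d], both [p p'] and all
    [p^k + p'^k] are polynomials on the base; they control [max |p| |p'|]. *)
Lemma step_dominates (N : nat) (E : Vec -> C) (S' H : Vec -> Prop) :
  is_poly (S N) E -> dominates (S N) S' H -> dominates (S N) (step N E S') (step N E H).
Proof.
  intros HE HD p Hp B HB v [x [d [Hx [Hdd ->]]]].
  destruct (poly_shift_even_odd N E p HE Hp) as [a [b [Ha [Hb Hab]]]].
  assert (Hneg : forall y e, (e * e)%K = E y -> ((- e) * (- e))%K = E y)
    by (intros y e <-; ring).
  assert (HS : forall y e, S' y -> (e * e)%K = E y ->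
    Cnorm (p (shift N y e)) <= B /\ Cnorm (p (shift N y (- e)%K)) <= B).
  { intros y e Hy He; split; apply HB; eexists; eexists; split; eauto. }
  set (u1 := p (shift N x d)); set (u2 := p (shift N x (- d)%K)).
  assert (Hprod : Cnorm (u1 * u2)%K <= B * B).
  { assert (Q : bounded_by S' (fun y => a y * a y - b y * b y * E y)%K (B * B)).
    (* [Csqrt] only supplies some root at each point; symmetric expressions do not depend on
       which. *)
    { intros y Hy; pose proof (Csqrt_sqr (E y)) as He.
      destruct (HS y _ Hy He) as [Q1 Q2].
      rewrite (Hab y _ He) in Q1; rewrite (Hab y _ (Hneg _ _ He)) in Q2.
      replace (a y * a y - b y * b y * E y)%K with
        ((a y + b y * Csqrt (E y)) * (a y + b y * (- Csqrt (E y))))%K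
        by (rewrite <- He at 3; ring).
      rewrite Cnorm_mul; apply Rmult_le_compat; auto using Cnorm_ge0. }
    apply HD in Q; [|auto using polyB, polyM].
    specialize (Q x Hx); unfold u1, u2.
    rewrite (Hab x d Hdd), (Hab x _ (Hneg _ _ Hdd)).
    replace ((a x + b x * d) * (a x + b x * (- d)))%K with
      (a x * a x - b x * b x * E x)%K by (rewrite <- Hdd; ring); auto. }
  assert (Hsum : forall k, Cnorm (Cpow u1 k + Cpow u2 k)%K <= 2 * B ^ k).
  { intro k.
    destruct (poly_shift_even_odd N E (fun v => Cpow (p v) k) HE (polyX _ _ k Hp))
      as [ak [bk [Hak [Hbk Hk]]]].
    assert (Q : bounded_by S' (fun y => ak y + ak y)%K (2 * B ^ k)).
    { intros y Hy; pose proof (Csqrt_sqr (E y)) as He.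
      destruct (HS y _ Hy He) as [Q1 Q2].
      replace (ak y + ak y)%K with
        (Cpow (p (shift N y (Csqrt (E y)))) k + Cpow (p (shift N y (- Csqrt (E y))%K)) k)%K
        by (rewrite (Hk y _ He), (Hk y _ (Hneg _ _ He)); ring).
      eapply Rle_trans; [apply Cnorm_add|]; rewrite !Cnorm_pow.
      pose proof (pow_incr _ _ k (conj (Cnorm_ge0 _) Q1)).
      pose proof (pow_incr _ _ k (conj (Cnorm_ge0 _) Q2)); lra. }
    apply HD in Q; [|auto using polyD]; specialize (Q x Hx); unfold u1, u2.
    rewrite (Hk x d Hdd), (Hk x _ (Hneg _ _ Hdd)).
    replace (ak x + bk x * d + (ak x + bk x * (- d)))%K with (ak x + ak x)%K by ring; auto. }
  assert (HB0 : 0 <= B).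
  { pose proof (Hsum 1%nat) as Q; rewrite pow_1 in Q.
    pose proof (Cnorm_ge0 (Cpow u1 1 + Cpow u2 1)%K); lra. }
  rewrite Cnorm_mul in Hprod.
  (* If [|u1| > B], the product bound forces [|u2| <= B], and then [|u1|^k <= 3 B^k] for all [k];
     but the powers of [|u1| / B] are unbounded. For [B = 0] the exponent 1 already gives a
     contradiction. *)
  apply Rnot_lt_le; intro Hlt; change (B < Cnorm u1) in Hlt.
  pose proof (Cnorm_ge0 u2) as Hu2.
  assert (Hu2B : Cnorm u2 <= B) by (apply Rnot_lt_le; intro; nra).
  assert (Hpow : forall k, Cnorm u1 ^ k <= 3 * B ^ k).
  { intro k; rewrite <- Cnorm_pow.
    pose proof (Cnorm_le_add (Cpow u1 k) (Cpow u1 k + Cpow u2 k)%K) as Q.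
    replace (Cpow u1 k - (Cpow u1 k + Cpow u2 k))%K with (- Cpow u2 k)%K in Q by ring.
    rewrite Cnorm_opp, (Cnorm_pow u2) in Q.
    pose proof (pow_incr _ _ k (conj Hu2 Hu2B)); specialize (Hsum k); lra. }
  destruct HB0 as [HB0|HB0].
  - destruct (Pow_x_infinity (Cnorm u1 / B)) with (b := 4) as [k Hk].
    + rewrite Rabs_pos_eq; [|apply Rmult_le_pos; [apply Cnorm_ge0|]].
      * apply Rmult_lt_reg_r with B; auto.
        unfold Rdiv; rewrite Rmult_assoc, Rinv_l by lra; lra.
      * apply Rlt_le, Rinv_0_lt_compat; lra.
    + specialize (Hk k (le_n _)); rewrite Rabs_pos_eq in Hk.
      * unfold Rdiv in Hk; rewrite Rpow_mult_distr, pow_inv in Hk.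
        pose proof (pow_lt B k HB0) as Hpk.
        apply Rge_le, (Rmult_le_compat_r (B ^ k)) in Hk; [|lra].
        rewrite Rmult_assoc, Rinv_l in Hk by lra; specialize (Hpow k); lra.
      * apply pow_le, Rmult_le_pos; [apply Cnorm_ge0|].
        apply Rlt_le, Rinv_0_lt_compat; lra.
  - specialize (Hpow 1%nat); rewrite !pow_1 in Hpow; lra.
Qed.

(** * A dense sequence of polynomials *)

Lemma poly_unif_cont (M : nat) (p : Vec -> C) (r eps : R) : is_poly M p -> 0 < eps ->
  exists delta, 0 < delta /\ forall v w, in_polydisc M r v ->
    (forall k, (k < M)%nat -> Cnorm (w k - v k)%K <= delta) -> Cnorm (p w - p v)%K <= eps.
Proof.
  intro Hp; revert eps; induction Hp as [c|k Hk|p q Hp IHp Hq IHq|p q Hp IHp Hq IHq];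
    intros eps He.
  - exists 1; split; [lra|]; intros v w _ _.
    replace (c - c)%K with C0 by ring; rewrite Cnorm_0; lra.
  - exists eps; split; auto.
  - destruct (IHp (eps / 2)) as [d1 [Hd1 H1]]; [lra|].
    destruct (IHq (eps / 2)) as [d2 [Hd2 H2]]; [lra|].
    exists (Rmin d1 d2); split; [now apply Rmin_glb_lt|]; intros v w Hv Hw; unfold fadd.
    replace (p w + q w - (p v + q v))%K with ((p w - p v) + (q w - q v))%K by ring.
    eapply Rle_trans; [apply Cnorm_add|].
    assert (Cnorm (p w - p v)%K <= eps / 2).
    { apply H1; auto; intros k Hk; eapply Rle_trans; [now apply Hw|apply Rmin_l]. }
    assert (Cnorm (q w - q v)%K <= eps / 2).
    { apply H2; auto; intros k Hk; eapply Rle_trans; [now apply Hw|apply Rmin_r]. }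
    lra.
  - destruct (poly_bounded M p r Hp) as [B [HB Hb]].
    (* The point [w] may leave the polydisc of radius [r], but by at most 1. *)
    destruct (poly_bounded M q (r + 1) Hq) as [B' [HB' Hb']].
    destruct (IHp (eps / (2 * (B' + 1)))) as [d1 [Hd1 H1]]; [apply Rdiv_lt_0_compat; lra|].
    destruct (IHq (eps / (2 * (B + 1)))) as [d2 [Hd2 H2]]; [apply Rdiv_lt_0_compat; lra|].
    exists (Rmin 1 (Rmin d1 d2)); split; [repeat apply Rmin_glb_lt; lra|].
    intros v w Hv Hw; unfold fmul.
    pose proof (Rmin_l 1 (Rmin d1 d2)); pose proof (Rmin_r 1 (Rmin d1 d2)).
    pose proof (Rmin_l d1 d2); pose proof (Rmin_r d1 d2).
    replace (p w * q w - p v * q v)%K with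
      ((p w - p v) * q w + p v * (q w - q v))%K by ring.
    eapply Rle_trans; [apply Cnorm_add|]; rewrite !Cnorm_mul.
    assert (Q1 : Cnorm (p w - p v)%K * Cnorm (q w) <= eps / (2 * (B' + 1)) * (B' + 1)).
    { apply Rmult_le_compat; auto using Cnorm_ge0.
      - apply H1; auto; intros k Hk; specialize (Hw k Hk); lra.
      - assert (Cnorm (q w) <= B'); [|lra].
        apply Hb'; intros k Hk; specialize (Hv k Hk); specialize (Hw k Hk).
        pose proof (Cnorm_le_add (w k) (v k)); lra. }
    assert (Q2 : Cnorm (p v) * Cnorm (q w - q v)%K <= (B + 1) * (eps / (2 * (B + 1)))).
    { apply Rmult_le_compat; auto using Cnorm_ge0.
      - specialize (Hb v Hv); lra.
      - apply H2; auto; intros k Hk; specialize (Hw k Hk); lra. }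
    replace (eps / (2 * (B' + 1)) * (B' + 1)) with (eps / 2) in Q1 by (field; lra).
    replace ((B + 1) * (eps / (2 * (B + 1)))) with (eps / 2) in Q2 by (field; lra).
    lra.
Qed.

(** * A countable dense family of polynomial expressions *)

Inductive pexpr : Type :=
| PI_ | PHalf | PVar (k : nat) | PAdd (e f : pexpr) | PMul (e f : pexpr).

Fixpoint peval (M : nat) (e : pexpr) (v : Vec) : C :=
  match e with
  | PI_ => mkC 0 1
  | PHalf => RtoC (1 / 2)
  | PVar k => if Nat.ltb k M then v k else C0
  | PAdd e f => (peval M e v + peval M f v)%K
  | PMul e f => (peval M e v * peval M f v)%K
  end.

Lemma peval_poly (M : nat) (e : pexpr) : is_poly M (peval M e).
Proof.
  induction e; simpl; try apply poly_const; auto using polyD, polyM.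
  destruct (Nat.ltb k M) eqn:h; [|apply poly_const].
  now apply poly_coord, Nat.ltb_lt.
Qed.

(** Codes are nested Cantor pairs of a tag and its arguments; every tag above 3 means a product.
    Fuel makes the recursion structural. *)
Fixpoint pdecode (fuel n : nat) : pexpr :=
  match fuel with
  | O => PI_
  | S f =>
    let (a, b) := Cantor.of_nat n in
    let (c, d) := Cantor.of_nat b in
    match a with
    | 0 => PI_
    | 1 => PHalf
    | 2 => PVar b
    | 3 => PAdd (pdecode f c) (pdecode f d)
    | _ => PMul (pdecode f c) (pdecode f d)
    end
  end%nat.

(** Allowing all larger amounts of fuel lets two subexpressions be decoded with a common amount. *)
Lemma pdecode_surj (e : pexpr) :
  exists f0 n, forall f, (f0 <= f)%nat -> pdecode f n = e.
Proof.
  assert (K : forall f a b, pdecode (S f) (Cantor.to_nat (a, b)) =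
    let (c, d) := Cantor.of_nat b in
    match a with
    | 0 => PI_ | 1 => PHalf | 2 => PVar b
    | 3 => PAdd (pdecode f c) (pdecode f d)
    | _ => PMul (pdecode f c) (pdecode f d)
    end%nat).
  { intros f a b; cbn [pdecode]; now rewrite Cantor.cancel_of_to. }
  induction e as [| |k|e1 [f1 [n1 H1]] e2 [f2 [n2 H2]]|e1 [f1 [n1 H1]] e2 [f2 [n2 H2]]].
  - exists 0%nat, (Cantor.to_nat (0, 0)%nat); intros [|f] _; [reflexivity|].
    rewrite K; now destruct (Cantor.of_nat 0).
  - exists 1%nat, (Cantor.to_nat (1, 0)%nat); intros [|f] h; [lia|].
    rewrite K; now destruct (Cantor.of_nat 0).
  - exists 1%nat, (Cantor.to_nat (2%nat, k)); intros [|f] h; [lia|].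
    rewrite K; now destruct (Cantor.of_nat k).
  - exists (S (f1 + f2)), (Cantor.to_nat (3%nat, Cantor.to_nat (n1, n2))).
    intros [|f] h; [lia|]; rewrite K, Cantor.cancel_of_to, H1, H2 by lia; reflexivity.
  - exists (S (f1 + f2)), (Cantor.to_nat (4%nat, Cantor.to_nat (n1, n2))).
    intros [|f] h; [lia|]; rewrite K, Cantor.cancel_of_to, H1, H2 by lia; reflexivity.
Qed.

(* The second component of [n] is ignored, so every expression recurs. *)
Definition penum (n : nat) : pexpr :=
  let (j, _) := Cantor.of_nat n in
  let (f, c) := Cantor.of_nat j in pdecode f c.

(** A polynomial has to be matched at a stage so late that branches are already near their limits
    and the tolerance [(1/2)^n] is small; one occurrence would not be enough. *)
Lemma penum_recurrent (e : pexpr) (n0 : nat) : exists n, (n0 <= n)%nat /\ penum n = e.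
Proof.
  destruct (pdecode_surj e) as [f [c H]].
  exists (Cantor.to_nat (Cantor.to_nat (f, c), n0)); split.
  - pose proof (Cantor.to_nat_non_decreasing (Cantor.to_nat (f, c)) n0); lia.
  - unfold penum; rewrite !Cantor.cancel_of_to; now apply H.
Qed.

Lemma real_near_multiple (x eta : R) : 0 <= x -> 0 < eta ->
  exists n, Rabs (x - INR n * eta) <= eta.
Proof.
  intros Hx He; destruct (INR_unbounded (x / eta)) as [K HK].
  assert (HKx : x <= INR K * eta).
  { replace x with (x / eta * eta) by (field; lra); apply Rmult_le_compat_r; lra. }
  clear HK; induction K as [|K IH].
  - exists 0%nat; simpl in *; rewrite Rabs_pos_eq; lra.
  - destruct (Rle_dec x (INR K * eta)) as [h|h]; [now apply IH|].
    exists K; rewrite S_INR in HKx; rewrite Rabs_pos_eq; lra.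
Qed.

(** Sums and products of [i] and 1/2 already give -1 and all dyadic Gaussian numbers, which are
    dense in the plane. *)
Lemma pexpr_const_dense (M : nat) (c : C) (eps : R) : 0 < eps ->
  exists e, forall v, Cnorm (c - peval M e v)%K <= eps.
Proof.
  intro He; pose (val := fun z : C => exists e, forall v, peval M e v = z).
  assert (VA : forall y z, val y -> val z -> val (y + z)%K).
  { intros y z [e1 H1] [e2 H2]; exists (PAdd e1 e2); intro v; simpl; now rewrite H1, H2. }
  assert (VM : forall y z, val y -> val z -> val (y * z)%K).
  { intros y z [e1 H1] [e2 H2]; exists (PMul e1 e2); intro v; simpl; now rewrite H1, H2. }
  assert (Vi : val (mkC 0 1)) by (exists PI_; reflexivity).
  assert (Vh : val (RtoC (1 / 2))) by (exists PHalf; reflexivity).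
  assert (V1 : val (RtoC 1)).
  { replace (RtoC 1) with (RtoC (1 / 2) + RtoC (1 / 2))%K by (C_coords; field); auto. }
  assert (Vm : val (RtoC (-1))).
  { replace (RtoC (-1)) with (mkC 0 1 * mkC 0 1)%K by (C_coords; ring); auto. }
  assert (V0 : val (RtoC 0)).
  { replace (RtoC 0) with (RtoC 1 + RtoC (-1))%K by (C_coords; ring); auto. }
  assert (Vn : forall n, val (RtoC (INR n))).
  { induction n; auto; rewrite S_INR.
    replace (RtoC (INR n + 1)) with (RtoC (INR n) + RtoC 1)%K by (C_coords; ring); auto. }
  assert (Vp : forall n, val (RtoC ((1 / 2) ^ n))).
  { induction n; simpl; auto.
    replace (RtoC (1 / 2 * (1 / 2) ^ n)) with (RtoC (1 / 2) * RtoC ((1 / 2) ^ n))%K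
      by (C_coords; ring); auto. }
  assert (VR : forall x, exists y, val (RtoC y) /\ Rabs (x - y) <= eps / 2).
  { intro x; destruct (pow_half_small (eps / 2)) as [k Hk]; [lra|].
    specialize (Hk k (le_n _)); pose proof (pow_lt (1 / 2) k ltac:(lra)) as Hk0.
    destruct (Rle_dec 0 x) as [h|h].
    - destruct (real_near_multiple x ((1 / 2) ^ k)) as [n Hn]; auto.
      exists (INR n * (1 / 2) ^ k); split; [|lra].
      replace (RtoC (INR n * (1 / 2) ^ k)) with (RtoC (INR n) * RtoC ((1 / 2) ^ k))%K
        by (C_coords; ring); auto.
    - destruct (real_near_multiple (- x) ((1 / 2) ^ k)) as [n Hn]; [lra|auto|].
      exists (- (INR n * (1 / 2) ^ k)); split.
      + replace (RtoC (- (INR n * (1 / 2) ^ k))) with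
          (RtoC (-1) * (RtoC (INR n) * RtoC ((1 / 2) ^ k)))%K by (C_coords; ring); auto.
      + rewrite <- Rabs_Ropp; replace (- (x - - (INR n * (1 / 2) ^ k))) with
          (- x - INR n * (1 / 2) ^ k) by ring; lra. }
  destruct (VR (Re c)) as [a [Va Ha]]; destruct (VR (Im c)) as [b [Vb Hb]].
  destruct (VA _ _ Va (VM _ _ Vi Vb)) as [e Hev]; exists e; intro v; rewrite Hev.
  eapply Rle_trans; [apply Cnorm_le_ReIm|].
  replace (Re (c - (RtoC a + mkC 0 1 * RtoC b))%K) with (Re c - a)
    by (unfold Csub, Cadd, Cmul, Copp, RtoC; simpl; ring).
  replace (Im (c - (RtoC a + mkC 0 1 * RtoC b))%K) with (Im c - b)
    by (unfold Csub, Cadd, Cmul, Copp, RtoC; simpl; ring).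
  lra.
Qed.

Lemma pexpr_dense (M : nat) (p : Vec -> C) (r eps : R) : is_poly M p -> 0 < eps ->
  exists e, forall v, in_polydisc M r v -> Cnorm (p v - peval M e v)%K <= eps.
Proof.
  intros Hp; revert eps; induction Hp as [c|k Hk|p q Hp IHp Hq IHq|p q Hp IHp Hq IHq];
    intros eps He.
  - destruct (pexpr_const_dense M c eps He) as [e H]; now exists e.
  - exists (PVar k); intros v _; simpl; rewrite (proj2 (Nat.ltb_lt k M) Hk).
    replace (v k - v k)%K with C0 by ring; rewrite Cnorm_0; lra.
  - destruct (IHp (eps / 2)) as [e1 H1]; [lra|]; destruct (IHq (eps / 2)) as [e2 H2]; [lra|].
    exists (PAdd e1 e2); intros v Hv; simpl; unfold fadd.
    replace (p v + q v - (peval M e1 v + peval M e2 v))%K with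
      ((p v - peval M e1 v) + (q v - peval M e2 v))%K by ring.
    eapply Rle_trans; [apply Cnorm_add|]; specialize (H1 v Hv); specialize (H2 v Hv); lra.
  - destruct (poly_bounded M q r Hq) as [B [HB Hb]].
    destruct (IHp (eps / (2 * (B + 1)))) as [e1 H1]; [apply Rdiv_lt_0_compat; lra|].
    destruct (poly_bounded M (peval M e1) r (peval_poly M e1)) as [B' [HB' Hb']].
    destruct (IHq (eps / (2 * (B' + 1)))) as [e2 H2]; [apply Rdiv_lt_0_compat; lra|].
    exists (PMul e1 e2); intros v Hv; simpl; unfold fmul.
    replace (p v * q v - (peval M e1 v * peval M e2 v))%K with
      ((p v - peval M e1 v) * q v + peval M e1 v * (q v - peval M e2 v))%K by ring.
    eapply Rle_trans; [apply Cnorm_add|]; rewrite !Cnorm_mul.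
    specialize (H1 v Hv); specialize (H2 v Hv); specialize (Hb v Hv); specialize (Hb' v Hv).
    assert (Q1 : Cnorm (p v - peval M e1 v)%K * Cnorm (q v) <= eps / (2 * (B + 1)) * (B + 1))
      by (apply Rmult_le_compat; auto using Cnorm_ge0; lra).
    assert (Q2 : Cnorm (peval M e1 v) * Cnorm (q v - peval M e2 v)%K
                 <= (B' + 1) * (eps / (2 * (B' + 1))))
      by (apply Rmult_le_compat; auto using Cnorm_ge0; lra).
    replace (eps / (2 * (B + 1)) * (B + 1)) with (eps / 2) in Q1 by (field; lra).
    replace ((B' + 1) * (eps / (2 * (B' + 1)))) with (eps / 2) in Q2 by (field; lra).
    lra.
Qed.

(** * The tower of square roots *)

(** The bound [1 - delta] on the last coordinate leaves room for all later increments, whose total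
    is at most [delta]; so every stage stays in one polydisc. *)
Definition good_stage (N : nat) (r0 : R) (H : Vec -> Prop) (delta : R) : Prop :=
  0 < delta /\
  (forall x, H x -> inCN (S N) x /\ in_polydisc N r0 x /\ Cnorm (x N) <= 1 - delta) /\
  retract N H delta /\ poly_dense_invertibles (S N) H.

(** [m] bounds the new roots from below. With [delta' <= delta / 2] a root and the tail after it fit
    into [delta]; [delta' <= m / 8] keeps the root recoverable. The factor [kappa] undoes the
    shrinking of [E] and, being positive, has a real square root. *)
Definition good_step (N : nat) (P : Vec -> C) (eta : R)
    (H : Vec -> Prop) (delta : R) (E : Vec -> C) (m delta' : R) : Prop :=
  is_poly (S N) E /\ 0 < m /\ delta' <= delta / 2 /\ delta' <= m / 8 /\
  (forall x, H x -> m * m <= Cnorm (E x) <= (delta / 2) * (delta / 2)) /\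
  (exists kappa, 0 < kappa /\
     forall x, H x -> Cnorm (RtoC kappa * E x - P x)%K <= eta).

Lemma in_polydisc_S (N : nat) (r0 s : R) (x : Vec) :
  in_polydisc N r0 x -> Cnorm (x N) <= s -> in_polydisc (S N) (Rmax r0 s) x.
Proof.
  intros Hx Hs k Hk; destruct (Nat.eq_dec k N) as [->|h].
  - eapply Rle_trans; [apply Hs|apply Rmax_r].
  - eapply Rle_trans; [apply Hx; lia|apply Rmax_l].
Qed.

Lemma good_step_exists (N : nat) (r0 : R) (P : Vec -> C) (eta : R)
  (H : Vec -> Prop) (delta : R) :
  good_stage N r0 H delta -> is_poly (S N) P -> 0 < eta ->
  exists E m delta', good_step N P eta H delta E m delta' /\
    good_stage N r0 (step N E H) delta'.
Proof.
  intros [Hd [HH [HR HDI]]] HP Heta; set (r := Rmax r0 (1 - delta)).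
  assert (Hr : forall x, H x -> in_polydisc (S N) r x)
    by (intros x Hx; destruct (HH x Hx) as [_ [? ?]]; now apply in_polydisc_S).
  destruct (HDI P HP eta Heta) as [q [s [Hq [Hs [Hqa Hqs]]]]].
  destruct (poly_bounded (S N) q r Hq) as [B [HB Hb]].
  (* This scaling makes the roots at most [delta / 2]; [B + 1] avoids a division by 0. *)
  set (lam := (delta / 2) * (delta / 2) / (B + 1)).
  assert (Hlam : 0 < lam) by (apply Rdiv_lt_0_compat; nra).
  set (E := fun x => (RtoC lam * q x)%K).
  assert (HE : is_poly (S N) E) by (apply polyM; auto using poly_const).
  assert (HEle : forall x, H x -> Cnorm (E x) <= (delta / 2) * (delta / 2)).
  { intros x Hx; unfold E; rewrite Cnorm_mul, Cnorm_RtoC, Rabs_pos_eq by lra.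
    replace (delta / 2 * (delta / 2)) with (lam * (B + 1)) by (unfold lam; field; lra).
    apply Rmult_le_compat_l; [lra|]; specialize (Hb x (Hr x Hx)); lra. }
  assert (Hinv : (forall x, H x -> E x <> C0) /\ inP (S N) H (fun x => Cinv (E x))).
  { apply (approx_inv Vec (S N) H (fun x => x) r Hr E (fun x => RtoC (/ lam) * s x)%K).
    - now apply (approx_poly Vec (S N) H (fun x => x)).
    - apply (approx_poly Vec (S N) H (fun x => x) (fun x => RtoC (/ lam) * s x)%K).
      apply polyM; auto using poly_const.
    - intros x Hx; unfold E.
      replace (RtoC lam * q x * (RtoC (/ lam) * s x))%K with (q x * s x)%K; auto.
      replace (RtoC lam * q x * (RtoC (/ lam) * s x))%K with
        ((RtoC lam * RtoC (/ lam)) * (q x * s x))%K by ring.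
      replace (RtoC lam * RtoC (/ lam))%K with C1 by (C_coords; field; lra); ring. }
  destruct Hinv as [Hn HI].
  destruct (step_retract N H r delta E) as [m [Hm [Hml HR']]]; auto.
  set (delta' := Rmin (m / 8) (delta / 2)).
  assert (Hd1 : delta' <= m / 8) by apply Rmin_l.
  assert (Hd2 : delta' <= delta / 2) by apply Rmin_r.
  exists E, m, delta'; split.
  - split; [|split; [|split; [|split; [|split]]]]; auto.
    exists (/ lam); split; [now apply Rinv_0_lt_compat|].
    intros x Hx; unfold E.
    replace (RtoC (/ lam) * (RtoC lam * q x))%K with (q x).
    + rewrite Cnorm_subC; auto.
    + replace (RtoC (/ lam) * (RtoC lam * q x))%K with
        ((RtoC (/ lam) * RtoC lam) * q x)%K by ring.
      replace (RtoC (/ lam) * RtoC lam)%K with C1 by (C_coords; field; lra); ring.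
  - split; [apply Rmin_glb_lt; lra|]; split; [|split].
    + intros v [x [d [Hx [Hdd ->]]]]; destruct (HH x Hx) as [H1 [H2 H3]].
      split; [|split].
      * intros k Hk; rewrite shift_other by lia; now apply H1.
      * intros k Hk; rewrite shift_other by lia; now apply H2.
      * rewrite shift_last; eapply Rle_trans; [apply Cnorm_add|].
        assert (Cnorm d <= delta / 2); [|lra].
        apply Cnorm_sqrt_le with (E x); auto; lra.
    + now apply HR'.
    + apply step_dense_invertibles with r delta; auto.
      intros x Hx; specialize (HEle x Hx); nra.
Qed.

Lemma dependent_choice {T : Type} (I : T -> Prop) (Rl : nat -> T -> T -> Prop) (t0 : T) :
  I t0 -> (forall n t, I t -> exists t', I t' /\ Rl n t t') ->
  exists s : nat -> T, s 0%nat = t0 /\ forall n, I (s n) /\ Rl n (s n) (s (S n)).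
Proof.
  intros H0 H.
  pose (next := fun n (t : {t | I t}) => constructive_indefinite_description _
    (H n (proj1_sig t) (proj2_sig t))).
  pose (s := fix s n : {t | I t} := match n with
    | O => exist _ t0 H0
    | S m => let (t', Ht') := next m (s m) in exist _ t' (proj1 Ht') end).
  exists (fun n => proj1_sig (s n)); split; auto; intro n; split.
  - apply proj2_sig.
  - simpl; destruct (next n (s n)) as [t' [H1 H2]]; auto.
Qed.

Lemma tower_exists (N : nat) (r0 : R) (P : nat -> Vec -> C) (H0 : Vec -> Prop) (delta0 : R) :
  (forall n, is_poly (S N) (P n)) -> good_stage N r0 H0 delta0 ->
  exists (Hs : nat -> Vec -> Prop) (E : nat -> Vec -> C) (m delta : nat -> R),
    Hs 0%nat = H0 /\ delta 0%nat = delta0 /\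
    forall n, good_stage N r0 (Hs n) (delta n) /\ Hs (S n) = step N (E n) (Hs n) /\
      good_step N (P n) ((1 / 2) ^ n) (Hs n) (delta n) (E n) (m n) (delta (S n)).
Proof.
  intros HP HG.
  destruct (@dependent_choice ((Vec -> Prop) * R * ((Vec -> C) * R))
    (fun t => good_stage N r0 (fst (fst t)) (snd (fst t)))
    (fun n t t' => fst (fst t') = step N (fst (snd t')) (fst (fst t)) /\
       good_step N (P n) ((1 / 2) ^ n) (fst (fst t)) (snd (fst t))
         (fst (snd t')) (snd (snd t')) (snd (fst t')))
    (H0, delta0, (fun _ => C0, 0))) as [s [Hs0 Hs]]; auto.
  - intros n [[H d] e] Ht; simpl in *.
    destruct (good_step_exists N r0 (P n) ((1 / 2) ^ n) H d) as [E [m [d' [H1 H2]]]]; auto.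
    + apply pow_lt; lra.
    + exists (step N E H, d', (E, m)); auto.
  (* A state carries the data of the step that produced it, so [E n] and [m n] sit in state [S n];
     those of the initial state are dummies. *)
  - exists (fun n => fst (fst (s n))), (fun n => fst (snd (s (S n)))),
      (fun n => snd (snd (s (S n)))), (fun n => snd (fst (s n))).
    split; [now rewrite Hs0|split; [now rewrite Hs0|]].
    intro n; destruct (Hs n) as [H1 [H2 H3]]; auto.
Qed.

(** * Characters of the limit algebra *)

Section Character.
Variables (I : Type) (M : nat) (D : I -> Prop) (g : I -> Vec) (r : R) (z : Vec).
Hypothesis g_bounded : forall i, D i -> in_polydisc M r (g i).
Hypothesis z_hull : forall p, is_poly M p ->
  forall B, (forall i, D i -> Cnorm (p (g i)) <= B) -> Cnorm (p z) <= B.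

(** The continuous extension of evaluation at [z], as a relation. Its arguments are functions of the
    index, so it applies to quantities attached to a branch rather than to a point. *)
Definition char_val (phi : I -> C) (c : C) : Prop :=
  forall eps, 0 < eps -> exists p, is_poly M p /\
    (forall i, D i -> Cnorm (phi i - p (g i))%K <= eps) /\ Cnorm (p z - c)%K <= eps.

Lemma char_val_approx phi c : char_val phi c -> approx M D g phi.
Proof. intros H eps He; destruct (H eps He) as [p [Hp [Ha _]]]; eauto. Qed.

(** The hull inequality, applied to differences of approximating polynomials, makes their values at
    [z] a Cauchy sequence. *)
Lemma char_val_exists phi : approx M D g phi -> exists c, char_val phi c.
Proof.
  intro H.
  assert (Hpos : forall n, 0 < (1 / 2) ^ n) by (intro; apply pow_lt; lra).
  pose (p := fun n => proj1_sig (constructive_indefinite_description _ (H _ (Hpos n)))).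
  assert (Hp : forall n, is_poly M (p n) /\
    forall i, D i -> Cnorm (phi i - p n (g i))%K <= (1 / 2) ^ n).
  { intro n; unfold p; apply proj2_sig. }
  destruct (C_complete (fun n => p n z) (fun n => 2 * (1 / 2) ^ n)) as [c Hc].
  - intros eps He; destruct (pow_half_small (eps / 2)) as [n0 Hn]; [lra|].
    exists n0; intros n h; specialize (Hn n h); lra.
  - intros n k h; apply (z_hull (fun v => p k v - p n v)%K).
    + apply polyB; apply Hp.
    + intros i Hi; eapply Rle_trans; [apply Cnorm_tri with (b := phi i)|].
      rewrite Cnorm_subC; pose proof (proj2 (Hp n) i Hi); pose proof (proj2 (Hp k) i Hi).
      assert ((1 / 2) ^ k <= (1 / 2) ^ n); [|lra].
      replace k with (n + (k - n))%nat by lia; rewrite pow_add.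
      pose proof (Hpos n); pose proof (pow_half_le_1 (k - n)); nra.
  - exists c; intros eps He; destruct (pow_half_small (eps / 2)) as [n Hn]; [lra|].
    specialize (Hn n (le_n _)); exists (p n); split; [apply Hp|split].
    + intros i Hi; pose proof (proj2 (Hp n) i Hi); lra.
    + rewrite Cnorm_subC; specialize (Hc n); simpl in Hc; lra.
Qed.

Lemma char_val_bound phi c B : char_val phi c ->
  (forall i, D i -> Cnorm (phi i) <= B) -> Cnorm c <= B.
Proof.
  intros H HB; apply Rle_plus_epsilon; intros eps He.
  destruct (H (eps / 2)) as [p [Hp [Ha Hc]]]; [lra|].
  assert (Cnorm (p z) <= B + eps / 2).
  { apply z_hull; auto; intros i Hi.
    pose proof (Cnorm_le_add (p (g i)) (phi i)) as Q; rewrite Cnorm_subC in Q.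
    specialize (Ha i Hi); specialize (HB i Hi); lra. }
  pose proof (Cnorm_le_add c (p z)) as Q; rewrite Cnorm_subC in Q; lra.
Qed.

Lemma char_val_poly p : is_poly M p -> char_val (fun i => p (g i)) (p z).
Proof.
  intros Hp eps He; exists p; split; [|split]; auto; intros;
    match goal with |- Cnorm ?x <= _ => replace x with C0 by ring end; rewrite Cnorm_0; lra.
Qed.

Lemma char_val_eq phi psi c :
  (forall i, D i -> phi i = psi i) -> char_val phi c -> char_val psi c.
Proof.
  intros E H eps He; destruct (H eps He) as [p [Hp [Ha Hc]]]; exists p.
  split; [|split]; auto; intros i Hi; rewrite <- E; auto.
Qed.

Lemma char_val_add phi psi c d :
  char_val phi c -> char_val psi d -> char_val (fun i => phi i + psi i)%K (c + d)%K.
Proof.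
  intros H1 H2 eps He; destruct (H1 (eps / 2)) as [p [Hp [Ha Hc]]]; [lra|].
  destruct (H2 (eps / 2)) as [q [Hq [Hb Hd]]]; [lra|].
  exists (fun v => p v + q v)%K; split; [now apply polyD|split].
  - intros i Hi; replace (phi i + psi i - (p (g i) + q (g i)))%K with
      ((phi i - p (g i)) + (psi i - q (g i)))%K by ring.
    eapply Rle_trans; [apply Cnorm_add|]; specialize (Ha i Hi); specialize (Hb i Hi); lra.
  - replace (p z + q z - (c + d))%K with ((p z - c) + (q z - d))%K by ring.
    eapply Rle_trans; [apply Cnorm_add|]; lra.
Qed.

Lemma char_val_mul phi psi c d :
  char_val phi c -> char_val psi d -> char_val (fun i => phi i * psi i)%K (c * d)%K.
Proof.
  intros H1 H2 eps He.
  destruct (approx_bounded I M D g r g_bounded phi (char_val_approx _ _ H1)) as [A [HA Ha]].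
  destruct (approx_bounded I M D g r g_bounded psi (char_val_approx _ _ H2)) as [B [HB Hb]].
  pose proof (char_val_bound _ _ _ H1 Ha) as Hc; pose proof (char_val_bound _ _ _ H2 Hb) as Hd.
  set (eta := Rmin 1 (eps / (A + B + 1))).
  assert (He1 : eta <= 1) by apply Rmin_l.
  assert (He2 : eta * (A + B + 1) <= eps).
  { replace eps with (eps / (A + B + 1) * (A + B + 1)) by (field; lra).
    apply Rmult_le_compat_r; [lra|apply Rmin_r]. }
  assert (He0 : 0 < eta) by (apply Rmin_glb_lt; [lra|apply Rdiv_lt_0_compat; lra]).
  destruct (H1 eta He0) as [p [Hp [Hpa Hpc]]]; destruct (H2 eta He0) as [q [Hq [Hqa Hqc]]].
  exists (fun v => p v * q v)%K; split; [now apply polyM|split].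
  - intros i Hi; eapply Rle_trans; [|apply He2].
    apply Cnorm_mul_sub_le; auto.
  - rewrite Cnorm_subC; eapply Rle_trans; [|apply He2].
    apply Cnorm_mul_sub_le; auto; rewrite Cnorm_subC; auto.
Qed.

Lemma char_val_const c : char_val (fun _ => c) c.
Proof. apply (char_val_poly (fun _ => c)), poly_const. Qed.

Lemma char_val_sub phi psi c d :
  char_val phi c -> char_val psi d -> char_val (fun i => phi i - psi i)%K (c - d)%K.
Proof.
  intros H1 H2; replace (c - d)%K with (c + (- C1) * d)%K by ring.
  apply char_val_eq with (fun i => phi i + (- C1) * psi i)%K; [intros; ring|].
  apply char_val_add; auto; apply char_val_mul; auto; apply char_val_const.
Qed.

Lemma char_val_unique phi c d : char_val phi c -> char_val phi d -> c = d.
Proof.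
  intros H1 H2; apply Csub_eq0, Cnorm_eq0.
  pose proof (char_val_bound _ _ 0 (char_val_sub _ _ _ _ H1 H2)) as Q.
  apply Rle_antisym; [|apply Cnorm_ge0]; apply Q; intros i _.
  replace (phi i - phi i)%K with C0 by ring; rewrite Cnorm_0; lra.
Qed.

Lemma char_val_poly_comp (L : nat) (u : Vec -> C) (x : I -> Vec) (w : Vec) : is_poly L u ->
  (forall k, (k < L)%nat -> char_val (fun i => x i k) (w k)) ->
  char_val (fun i => u (x i)) (u w).
Proof.
  intros Hu Hx; induction Hu; auto using char_val_const.
  - now apply char_val_add.
  - now apply char_val_mul.
Qed.

End Character.

(** * The limit set *)

Definition sgn (b : bool) (d : C) : C := if b then d else (- d)%K.

Fixpoint branch (N : nat) (E : nat -> Vec -> C) (y : Vec) (s : nat -> bool) (n : nat) : Vec :=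
  match n with
  | O => y
  | S n' => let x := branch N E y s n' in shift N x (sgn (s n') (Csqrt (E n' x)))
  end.

(** The base is left free: the same [E] is used over [Y] and over its hull, and the two towers are
    compared stage by stage. *)
Fixpoint iter_step (N : nat) (E : nat -> Vec -> C) (B : Vec -> Prop) (n : nat) : Vec -> Prop :=
  match n with
  | O => B
  | S n' => step N (E n') (iter_step N E B n')
  end.

Lemma sgn_sqr (b : bool) (d : C) : (sgn b d * sgn b d)%K = (d * d)%K.
Proof. destruct b; simpl; ring. Qed.

Lemma branch_ext N E y s t n :
  (forall k, (k < n)%nat -> s k = t k) -> branch N E y s n = branch N E y t n.
Proof.
  induction n as [|n IH]; intro H; simpl; auto.
  rewrite IH, (H n) by (auto with arith); reflexivity.
Qed.

Lemma iter_step_branch N E B n x :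
  iter_step N E B n x <-> exists y s, B y /\ x = branch N E y s n.
Proof.
  split.
  - revert x; induction n as [|n IH]; intros x.
    + intro Hx; exists x, (fun _ => true); auto.
    + intros [x' [d [Hx' [Hd ->]]]]; destruct (IH x' Hx') as [y [s [Hy ->]]].
      assert (Hb : exists b, d = sgn b (Csqrt (E n (branch N E y s n)))).
      { destruct (Csqr_roots d (Csqrt (E n (branch N E y s n)))) as [->| ->].
        - now rewrite Csqrt_sqr.
        - now exists true.
        - now exists false. }
      destruct Hb as [b Hb].
      (* Only the sign at [n] is changed, which the first [n] steps do not see. *)
      exists y, (fun k => if Nat.eqb k n then b else s k); split; auto; simpl.
      rewrite Nat.eqb_refl, (branch_ext N E y (fun k => if Nat.eqb k n then b else s k) s n),
        <- Hb; auto.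
      intros k Hk; now rewrite (proj2 (Nat.eqb_neq k n)) by lia.
  - intros [y [s [Hy ->]]]; induction n as [|n IH]; simpl; auto.
    eexists; eexists; split; [exact IH|split; [|reflexivity]].
    rewrite sgn_sqr; apply Csqrt_sqr.
Qed.

Section Limit.
Variables (N : nat) (r0 : R) (H0 : Vec -> Prop).
Variables (Hs : nat -> Vec -> Prop) (E : nat -> Vec -> C) (m delta : nat -> R).
Hypothesis H0_inCN : forall y, H0 y -> inCN N y.
Hypothesis Hs_0 : Hs 0%nat = H0.
Hypothesis delta_0 : delta 0%nat = 1.
Hypothesis tower : forall n, good_stage N r0 (Hs n) (delta n) /\
  Hs (S n) = step N (E n) (Hs n) /\
  good_step N (peval (S N) (penum n)) ((1 / 2) ^ n) (Hs n) (delta n) (E n) (m n) (delta (S n)).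

Local Notation br := (branch N E).

Lemma Hs_iter n : Hs n = iter_step N E H0 n.
Proof.
  induction n as [|n IH]; simpl; auto; now rewrite (proj1 (proj2 (tower n))), IH.
Qed.

Lemma branch_in y s n : H0 y -> Hs n (br y s n).
Proof. intro Hy; rewrite Hs_iter; apply iter_step_branch; eauto. Qed.

Lemma delta_gt0 n : 0 < delta n.
Proof. apply (tower n). Qed.

Lemma delta_half n : delta (S n) <= delta n / 2.
Proof. apply (tower n). Qed.

Lemma delta_le n : delta n <= (1 / 2) ^ n.
Proof.
  induction n as [|n IH]; simpl; [lra|]; pose proof (delta_half n); lra.
Qed.

Lemma E_poly n : is_poly (S N) (E n).
Proof. apply (tower n). Qed.

Lemma branch_increment y s n : H0 y ->
  m n <= Cnorm (sgn (s n) (Csqrt (E n (br y s n)))) <= delta n / 2.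
Proof.
  intro Hy; destruct (tower n) as [_ [_ [_ [Hm [_ [_ [Hb _]]]]]]].
  specialize (Hb _ (branch_in y s n Hy)); pose proof (delta_gt0 n).
  assert (Hq : (sgn (s n) (Csqrt (E n (br y s n))) *
                sgn (s n) (Csqrt (E n (br y s n))))%K = E n (br y s n))
    by (rewrite sgn_sqr; apply Csqrt_sqr).
  split.
  - apply Cnorm_sqrt_ge with (1 := Hq); lra.
  - apply Cnorm_sqrt_le with (1 := Hq); lra.
Qed.

(** Each increment is at most [delta n / 2], and [delta n - delta (S n)] is at least that much, so
    the bounds telescope. *)
Lemma branch_cauchy y s n k : H0 y ->
  exists t, Cnorm t <= delta n - delta (n + k) /\ br y s (n + k) = shift N (br y s n) t.
Proof.
  intro Hy; induction k as [|k [t [Ht IH]]].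
  - exists C0; rewrite Nat.add_0_r, Cnorm_0; split; [lra|].
    apply functional_extensionality; intro j; unfold shift.
    destruct (Nat.eqb j N); auto; ring.
  - rewrite Nat.add_succ_r; simpl; rewrite IH, shift_shift; eexists; split; [|reflexivity].
    rewrite <- IH; eapply Rle_trans; [apply Cnorm_add|].
    pose proof (branch_increment y s (n + k) Hy); pose proof (delta_half (n + k)); lra.
Qed.

(** A tail of size at most [delta n] at every stage is exactly what [retract] tolerates. *)
Definition is_branch_limit (y : Vec) (s : nat -> bool) (l : Vec) : Prop :=
  forall n, exists t, Cnorm t <= delta n /\ l = shift N (br y s n) t.

Definition branch_limit (y : Vec) (s : nat -> bool) : Vec :=
  epsilon (inhabits y) (is_branch_limit y s).

Definition limit_set (B : Vec -> Prop) (l : Vec) : Prop :=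
  exists y s, B y /\ l = branch_limit y s.

Lemma branch_limit_spec y s : H0 y -> is_branch_limit y s (branch_limit y s).
Proof.
  intro Hy; unfold branch_limit; apply epsilon_spec.
  destruct (C_complete (fun n => br y s n N) delta) as [l Hl].
  - intros eps He; destruct (pow_half_small eps He) as [n0 Hn]; exists n0; intros n h.
    pose proof (delta_le n); specialize (Hn n h); lra.
  - intros n k h; destruct (branch_cauchy y s n (k - n) Hy) as [t [Ht Eq]].
    replace (n + (k - n))%nat with k in * by lia; rewrite Eq, shift_last.
    replace (br y s n N + t - br y s n N)%K with t by ring.
    pose proof (delta_gt0 k); lra.
  - exists (shift N y (l - y N)%K); intro n; exists (l - br y s n N)%K; split; auto.
    destruct (branch_cauchy y s 0 n Hy) as [t [_ Eq]]; simpl in Eq.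
    rewrite Eq, shift_shift, shift_last; f_equal; ring.
Qed.

Lemma branch_limit_other y s k : H0 y -> k <> N -> branch_limit y s k = y k.
Proof.
  intros Hy Hk; destruct (branch_limit_spec y s Hy 0%nat) as [t [_ ->]]; simpl.
  now apply shift_other.
Qed.

Lemma branch_limit_inCN y s : H0 y -> inCN (S N) (branch_limit y s).
Proof.
  intros Hy k Hk; rewrite branch_limit_other by (auto || lia); apply H0_inCN; auto; lia.
Qed.

Lemma proj_branch_limit y s : H0 y -> proj N (branch_limit y s) = y.
Proof.
  intro Hy; apply functional_extensionality; intro k; unfold proj.
  destruct (Nat.ltb k N) eqn:h.
  - apply Nat.ltb_lt in h; apply branch_limit_other; auto; lia.
  - apply Nat.ltb_ge in h; symmetry; now apply H0_inCN.
Qed.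

Definition limit_radius : R := Rmax r0 1.

Lemma branch_polydisc y s n : H0 y -> in_polydisc (S N) limit_radius (br y s n).
Proof.
  intro Hy; destruct (tower n) as [[Hd [Hg _]] _].
  destruct (Hg _ (branch_in y s n Hy)) as [_ [H1 H2]]; apply in_polydisc_S; auto; lra.
Qed.

Lemma branch_limit_polydisc y s : H0 y -> in_polydisc (S N) limit_radius (branch_limit y s).
Proof.
  intro Hy; pose proof (tower 0%nat) as [[_ [Hg _]] _].
  specialize (Hg _ (branch_in y s 0 Hy)); destruct Hg as [_ [H1 H2]].
  destruct (branch_limit_spec y s Hy 0%nat) as [t [Ht ->]]; simpl in *.
  rewrite delta_0 in *; apply in_polydisc_S.
  - intros k Hk; rewrite shift_other by lia; auto.
  - rewrite shift_last; eapply Rle_trans; [apply Cnorm_add|]; lra.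
Qed.

Lemma branch_limit_close y s n k : H0 y ->
  Cnorm (branch_limit y s k - br y s n k)%K <= delta n.
Proof.
  intro Hy; destruct (branch_limit_spec y s Hy n) as [t [Ht ->]]; unfold shift.
  pose proof (delta_gt0 n); destruct (Nat.eqb k N).
  - replace (br y s n k + t - br y s n k)%K with t by ring; auto.
  - replace (br y s n k - br y s n k)%K with C0 by ring; rewrite Cnorm_0; lra.
Qed.

(** * The limit algebra: stages, squares, invertibles, domination *)

Local Notation D := (fun i : Vec * (nat -> bool) => H0 (fst i)).
Local Notation g := (fun i : Vec * (nat -> bool) => branch_limit (fst i) (snd i)).

Lemma branch_limits_bounded : forall i, D i -> in_polydisc (S N) limit_radius (g i).
Proof. intros i Hi; now apply branch_limit_polydisc. Qed.

(** A limit point is a perturbation of its stage [n] by at most [delta n], so the retraction of that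
    stage applies to it. *)
Lemma branch_approx n k : (k < S N)%nat ->
  approx (S N) D g (fun i => br (fst i) (snd i) n k).
Proof.
  revert k; apply (retract_coord N (Hs n) (delta n) D g (fun i => br (fst i) (snd i) n)).
  - apply (tower n).
  - intros i Hi; split; [now apply branch_in|now apply branch_limit_spec].
Qed.

Lemma poly_branch_close p eps : is_poly (S N) p -> 0 < eps ->
  exists n0, forall n, (n0 <= n)%nat -> forall y s, H0 y ->
    Cnorm (p (branch_limit y s) - p (br y s n))%K <= eps.
Proof.
  intros Hp He; destruct (poly_unif_cont (S N) p limit_radius eps Hp He) as [d [Hd H]].
  destruct (pow_half_small d Hd) as [n0 Hn]; exists n0; intros n h y s Hy.
  apply H; [now apply branch_polydisc|]; intros k _.
  eapply Rle_trans; [now apply branch_limit_close|].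
  pose proof (delta_le n); specialize (Hn n h); lra.
Qed.

(** At a suitable late stage [p] is close to [kap * E n], the square of [sqrt kap] times the
    increment of the last coordinate. The increment is a difference of two stages and so lies in the
    limit algebra. *)
Lemma limit_squares_dense p eps : is_poly (S N) p -> 0 < eps ->
  exists q, is_poly (S N) q /\
    forall l, limit_set H0 l -> Cnorm (p l - q l * q l)%K <= eps.
Proof.
  intros Hp He.
  destruct (pexpr_dense (S N) p limit_radius (eps / 4) Hp) as [e Hpe]; [lra|].
  destruct (poly_branch_close p (eps / 4) Hp) as [n1 Hn1]; [lra|].
  destruct (pow_half_small (eps / 4)) as [n2 Hn2]; [lra|].
  destruct (penum_recurrent e (n1 + n2)) as [n [Hn Hen]].
  destruct (tower n) as [_ [_ [_ [_ [_ [_ [_ [kap [Hkap HE]]]]]]]]].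
  pose (phi := fun i : Vec * (nat -> bool) => (RtoC (sqrt kap) *
    (br (fst i) (snd i) (S n) N - br (fst i) (snd i) n N))%K).
  assert (Hphi : approx (S N) D g phi).
  { apply (approx_mul _ (S N) D g _ branch_limits_bounded); [apply approx_const|].
    apply (approx_sub _ (S N) D g _ branch_limits_bounded); apply branch_approx; lia. }
  assert (Hsq : forall i, D i -> (phi i * phi i)%K = (RtoC kap * E n (br (fst i) (snd i) n))%K).
  { intros [y s] Hy; unfold phi; cbn [fst snd branch]; rewrite shift_last.
    set (d := sgn (s n) (Csqrt (E n (br y s n)))).
    replace (RtoC (sqrt kap) * (br y s n N + d - br y s n N) *
      (RtoC (sqrt kap) * (br y s n N + d - br y s n N)))%K with
      ((RtoC (sqrt kap) * RtoC (sqrt kap)) * (d * d))%K by ring.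
    unfold d; rewrite sgn_sqr, Csqrt_sqr; f_equal.
    rewrite <- (sqrt_sqrt kap) at 3 by lra; C_coords; ring. }
  destruct (approx_bounded _ _ _ _ _ branch_limits_bounded phi Hphi) as [B [HB Hb]].
  set (eta := Rmin 1 (eps / 4 / (B + B + 1))).
  assert (He1 : eta <= 1) by apply Rmin_l.
  assert (He2 : eta * (B + B + 1) <= eps / 4).
  { replace (eps / 4) with (eps / 4 / (B + B + 1) * (B + B + 1)) by (field; lra).
    apply Rmult_le_compat_r; [lra|apply Rmin_r]. }
  assert (He0 : 0 < eta) by (apply Rmin_glb_lt; [lra|apply Rdiv_lt_0_compat; lra]).
  destruct (Hphi eta He0) as [q [Hq Hqa]]; exists q; split; auto.
  intros l [y [s [Hy ->]]].
  specialize (Hn1 n ltac:(lia) y s Hy); specialize (Hn2 n ltac:(lia)).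
  specialize (Hpe _ (branch_polydisc y s n Hy)).
  specialize (HE _ (branch_in y s n Hy)); rewrite Hen in HE.
  specialize (Hqa (y, s) Hy); specialize (Hb (y, s) Hy); specialize (Hsq (y, s) Hy).
  cbn [fst snd] in *.
  pose proof (Cnorm_mul_sub_le _ _ _ _ _ _ _ Hqa Hqa He1 Hb Hb) as Q; rewrite Hsq in Q.
  rewrite Cnorm_subC in HE.
  pose proof (Cnorm_tri (p (branch_limit y s)) (p (br y s n))
    (q (branch_limit y s) * q (branch_limit y s))) as T1.
  pose proof (Cnorm_tri (p (br y s n)) (peval (S N) e (br y s n))
    (q (branch_limit y s) * q (branch_limit y s))) as T2.
  pose proof (Cnorm_tri (peval (S N) e (br y s n)) (RtoC kap * E n (br y s n))
    (q (branch_limit y s) * q (branch_limit y s))) as T3.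
  lra.
Qed.

(** Up to a uniform error [p] may be evaluated at a finite stage; an invertible approximation found
    there is carried to the limit by [branch_approx]. *)
Lemma limit_dense_invertibles : poly_dense_invertibles (S N) (limit_set H0).
Proof.
  intros p Hp eps He.
  destruct (poly_branch_close p (eps / 4) Hp) as [n Hn]; [lra|].
  specialize (Hn n (le_n _)).
  destruct (tower n) as [[_ [_ [_ HDI]]] _].
  destruct (HDI p Hp (eps / 4)) as [q [s [Hq [Hs' [Ha Hb]]]]]; [lra|].
  pose proof (approx_poly_comp _ (S N) D g _ branch_limits_bounded (S N) q
    (fun i => br (fst i) (snd i) n) Hq (branch_approx n)) as Aq.
  pose proof (approx_poly_comp _ (S N) D g _ branch_limits_bounded (S N) s
    (fun i => br (fst i) (snd i) n) Hs' (branch_approx n)) as As.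
  destruct (approx_inv _ (S N) D g _ branch_limits_bounded _ _ Aq As) as [Hnz Ai].
  { intros i Hi; apply Hb, branch_in, Hi. }
  destruct (approx_invertible_poly (S N) D g _ _ _ (eps / 4) branch_limits_bounded Aq Ai)
    as [q' [s' [Hq' [Hs'' [Hc Hd]]]]]; [|lra|].
  { intros i Hi; apply Cinv_r; auto. }
  exists q', s'; split; [|split; [|split]]; auto; intros l [y [t [Hy ->]]].
  - specialize (Hn y t Hy); specialize (Ha _ (branch_in y t n Hy)).
    specialize (Hc (y, t) Hy); cbn [fst snd] in Hc.
    pose proof (Cnorm_tri (p (branch_limit y t)) (p (br y t n)) (q' (branch_limit y t))).
    pose proof (Cnorm_tri (p (br y t n)) (q (br y t n)) (q' (branch_limit y t))).
    lra.
  - apply (Hd (y, t) Hy).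
Qed.

Lemma limit_dominates (B : Vec -> Prop) : (forall y, B y -> H0 y) ->
  dominates (S N) B H0 -> dominates (S N) (limit_set B) (limit_set H0).
Proof.
  intros HB HD p Hp K HK l [y [s [Hy ->]]].
  apply Rle_plus_epsilon; intros eps He.
  destruct (poly_branch_close p (eps / 2) Hp) as [n Hn]; [lra|].
  specialize (Hn n (le_n _)).
  (* Domination passes through finitely many root extensions; replacing limits by stage [n] costs
     [eps / 2] on either side. *)
  assert (HDn : dominates (S N) (iter_step N E B n) (iter_step N E H0 n)).
  { clear Hn; induction n as [|n IH]; simpl; auto; apply step_dominates; auto using E_poly. }
  assert (Hbd : bounded_by (iter_step N E B n) p (K + eps / 2)).
  { intros x Hx; apply iter_step_branch in Hx; destruct Hx as [y' [s' [Hy' ->]]].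
    pose proof (Cnorm_le_add (p (br y' s' n)) (p (branch_limit y' s'))) as Q.
    rewrite Cnorm_subC in Q; specialize (Hn y' s' (HB _ Hy')).
    assert (Cnorm (p (branch_limit y' s')) <= K) by (apply HK; exists y', s'; auto).
    lra. }
  assert (Hbn : iter_step N E H0 n (br y s n)) by (apply iter_step_branch; eauto).
  pose proof (HDn p Hp _ Hbd _ Hbn); specialize (Hn y s Hy).
  pose proof (Cnorm_le_add (p (branch_limit y s)) (p (br y s n))); lra.
Qed.

(** * The hull of the limit set *)

Lemma branch_limit_unique y s l : H0 y -> is_branch_limit y s l -> l = branch_limit y s.
Proof.
  intros Hy Hl; pose proof (branch_limit_spec y s Hy) as HL.
  destruct (Hl 0%nat) as [t [_ Et]]; destruct (HL 0%nat) as [t' [_ Et']].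
  rewrite Et, Et'; f_equal; apply Csub_eq0, Cnorm_close0; intros eps He.
  destruct (pow_half_small (eps / 2)) as [n Hn]; [lra|]; specialize (Hn n (le_n _)).
  pose proof (delta_le n).
  destruct (Hl n) as [u [Hu Eu]]; destruct (HL n) as [u' [Hu' Eu']].
  replace (t - t')%K with (u - u')%K.
  - eapply Rle_trans; [apply Cnorm_sub|]; lra.
  - apply (f_equal (fun v => v N)) in Et, Et', Eu, Eu'.
    rewrite shift_last in Et, Et', Eu, Eu'.
    replace (u - u')%K with ((br y s n N + u) - (br y s n N + u'))%K by ring.
    rewrite <- Eu, <- Eu', Et, Et'; ring.
Qed.

(** The character at [z] gives the last coordinate of stage [n] a value [c n]. Being multiplicative,
    it preserves the equation between the squared increment and [E n], so these values form a branch
    over [proj N z]; being bounded by the sup norm, it keeps [c n] within [delta n] of [z N]. *)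
Lemma limit_hull z : hull (S N) (limit_set H0) z -> H0 (proj N z) -> limit_set H0 z.
Proof.
  intros [Hz Hh] Hy.
  assert (z_hull : forall p, is_poly (S N) p ->
    forall B, (forall i, D i -> Cnorm (p (g i)) <= B) -> Cnorm (p z) <= B).
  { intros p Hp B HB; apply Hh; auto; intros l [y [s [Hy' ->]]]; now apply (HB (y, s)). }
  set (cv := char_val _ (S N) D g z).
  assert (Ex : forall n, exists c, cv (fun i => br (fst i) (snd i) n N) c).
  { intro n; apply char_val_exists; auto; apply branch_approx; lia. }
  apply choice in Ex; destruct Ex as [c Hc].
  pose (w := fun n => shift N (proj N z) (c n)).
  assert (HzN : proj N z N = C0) by (unfold proj; now rewrite Nat.ltb_irrefl).
  assert (Hw : forall n k, (k < S N)%nat -> cv (fun i => br (fst i) (snd i) n k) (w n k)).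
  { intros n k Hk; destruct (Nat.eq_dec k N) as [->|hk].
    - unfold w; rewrite shift_last, HzN; replace (C0 + c n)%K with (c n) by ring; auto.
    - unfold w; rewrite shift_other by auto; unfold proj.
      rewrite (proj2 (Nat.ltb_lt k N)) by lia.
      apply char_val_eq with (fun i => g i k).
      + intros [y s] Hi; cbn [fst snd]; destruct (branch_limit_spec y s Hi n) as [t [_ ->]].
        now apply shift_other.
      + apply (char_val_poly _ (S N) D g z (fun v => v k)), poly_coord; auto. }
  assert (Hc0 : c 0%nat = C0).
  { apply (char_val_unique _ (S N) D g _ z branch_limits_bounded z_hull
      (fun i => br (fst i) (snd i) 0 N)).
    - apply Hc.
    - apply char_val_eq with (fun _ => C0); [|apply char_val_const].
      intros i Hi; simpl; symmetry; apply H0_inCN; auto. }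
  assert (Hstep : forall n, ((c (S n) - c n) * (c (S n) - c n))%K = E n (w n)).
  { intro n.
    pose proof (char_val_sub _ (S N) D g _ z branch_limits_bounded z_hull _ _ _ _
      (Hc (S n)) (Hc n)) as H1.
    pose proof (char_val_mul _ (S N) D g _ z branch_limits_bounded z_hull _ _ _ _ H1 H1) as H2.
    refine (char_val_unique _ (S N) D g _ z branch_limits_bounded z_hull _ _ _ H2 _).
    apply char_val_eq with (fun i => E n (br (fst i) (snd i) n)).
    - intros [y s] Hi; cbn [fst snd branch]; rewrite shift_last.
      set (d := sgn (s n) (Csqrt (E n (br y s n)))).
      replace ((br y s n N + d - br y s n N) * (br y s n N + d - br y s n N))%K
        with (d * d)%K by ring.
      unfold d; now rewrite sgn_sqr, Csqrt_sqr.
    - apply (char_val_poly_comp _ (S N) D g _ z branch_limits_bounded z_hull (S N) (E n)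
        (fun i => br (fst i) (snd i) n)); [apply E_poly|exact (Hw n)]. }
  (* An increment of [c] is a root of [E n (w n)], so it is the principal root up to a sign, which
     is read off here. *)
  pose (s := fun n => if excluded_middle_informative
    ((c (S n) - c n)%K = Csqrt (E n (w n))) then true else false).
  assert (Hbr : forall n, br (proj N z) s n = w n).
  { induction n as [|n IH].
    - simpl; unfold w; rewrite Hc0; apply functional_extensionality; intro k.
      unfold shift; destruct (Nat.eqb k N); auto; ring.
    - cbn [branch]; rewrite IH.
      assert (Hd : sgn (s n) (Csqrt (E n (w n))) = (c (S n) - c n)%K).
      { unfold s; destruct excluded_middle_informative as [h|h]; simpl; auto.
        destruct (Csqr_roots (c (S n) - c n)%K (Csqrt (E n (w n)))) as [h'|h'].
        - now rewrite Csqrt_sqr.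
        - contradiction.
        - now rewrite h'. }
      rewrite Hd; unfold w; rewrite shift_shift; f_equal; ring. }
  exists (proj N z), s; split; auto; apply branch_limit_unique; auto.
  intro n; exists (z N - c n)%K; split.
  - apply (char_val_bound _ (S N) D g z z_hull
      (fun i => g i N - br (fst i) (snd i) n N)%K).
    + apply (char_val_sub _ (S N) D g _ z branch_limits_bounded z_hull); [|exact (Hc n)].
      apply (char_val_poly _ (S N) D g z (fun v => v N)), poly_coord; lia.
    + intros i Hi; now apply branch_limit_close.
  - rewrite Hbr; unfold w; rewrite shift_shift.
    apply functional_extensionality; intro k; unfold shift, proj.
    destruct (Nat.eqb k N) eqn:hk; [apply Nat.eqb_eq in hk; subst k|].
    + rewrite Nat.ltb_irrefl; ring.
    + destruct (Nat.ltb k N) eqn:hl; auto.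
      apply Nat.eqb_neq in hk; apply Nat.ltb_ge in hl; apply Hz; lia.
Qed.

(** * The fibres as Cantor sets *)

Lemma branch_limit_gap y s t n : H0 y -> (forall k, (k < n)%nat -> s k = t k) ->
  Cnorm (branch_limit y s N - branch_limit y t N)%K < m n -> s n = t n.
Proof.
  intros Hy Hst Hlt.
  destruct (Bool.bool_dec (s n) (t n)) as [|Hne]; auto; exfalso.
  pose proof (branch_limit_close y s (S n) N Hy) as H1.
  pose proof (branch_limit_close y t (S n) N Hy) as H2.
  cbn [branch] in H1, H2; rewrite shift_last in H1, H2.
  rewrite <- (branch_ext N E y s t n Hst) in H2.
  pose proof (branch_increment y s n Hy) as [H3 _].
  destruct (tower n) as [_ [_ [_ [Hm [_ [Hd8 _]]]]]].
  set (x := br y s n) in *; set (d := Csqrt (E n x)) in *.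
  assert (H4 : sgn (t n) d = (- sgn (s n) d)%K).
  { destruct (s n), (t n); simpl; try (exfalso; apply Hne; reflexivity); ring. }
  rewrite H4 in H2; set (e := sgn (s n) d) in *.
  (* Opposite signs put the two limits [2 |e|] apart, up to two tails of size at most [m n / 8];
     since [|e| >= m n], their distance cannot be below [m n]. *)
  assert (H5 : Cnorm (e + e)%K <= m n + delta (S n) + delta (S n)).
  { replace (e + e)%K with
      ((branch_limit y s N - branch_limit y t N)
       - ((branch_limit y s N - (x N + e)) - (branch_limit y t N - (x N + - e))))%K by ring.
    eapply Rle_trans; [apply Cnorm_sub|].
    eapply Rle_trans; [apply Rplus_le_compat_l, Cnorm_sub|]; lra. }
  assert (H6 : Cnorm (e + e)%K = 2 * Cnorm e).
  { replace (e + e)%K with (RtoC 2 * e)%K by (C_coords; ring).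
    rewrite Cnorm_mul, Cnorm_RtoC, Rabs_pos_eq; lra. }
  lra.
Qed.

Lemma m_gt0 n : 0 < m n.
Proof. apply (tower n). Qed.

Lemma limit_fibre_cantor y : H0 y ->
  is_cantor (S N) (fun x => limit_set H0 x /\ proj N x = y).
Proof.
  intro Hy.
  assert (inj : forall s t, branch_limit y s = branch_limit y t -> s = t).
  { intros s t Est.
    assert (H : forall n k, (k < n)%nat -> s k = t k).
    { induction n as [|n IH]; intros k Hk; [lia|].
      destruct (Nat.eq_dec k n) as [->|h]; [|apply IH; lia].
      apply (branch_limit_gap y s t n Hy IH); rewrite Est.
      match goal with |- Cnorm ?x < _ => replace x with C0 by ring end.
      rewrite Cnorm_0; apply m_gt0. }
    apply functional_extensionality; intro k; apply (H (S k)); lia. }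
  exists (fun x => epsilon (inhabits (fun _ => true)) (fun s => branch_limit y s = x)),
    (branch_limit y).
  assert (F : forall x, limit_set H0 x /\ proj N x = y -> branch_limit y
    (epsilon (inhabits (fun _ => true)) (fun s => branch_limit y s = x)) = x).
  { intros x [[y' [s [Hy' ->]]] Hp].
    apply (epsilon_spec (inhabits (fun _ => true)) (fun s0 => branch_limit y s0 = _)).
    rewrite proj_branch_limit in Hp by auto; subst y'; eauto. }
  assert (G : forall s, limit_set H0 (branch_limit y s) /\ proj N (branch_limit y s) = y).
  { intro s; split; [exists y, s; auto|now apply proj_branch_limit]. }
  split; [|split; [|split]].
  - exact F.
  - intro s; split; auto; apply inj, F, G.
  - intros x Hx n.
    (* Within a distance below all of the first [n] gaps the signs agree one after the other: each
       use of the gap presupposes that the earlier signs agree. *)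
    assert (Hmin : exists d, 0 < d /\ forall k, (k < n)%nat -> d <= m k).
    { induction n as [|n [d [Hd IH]]]; [exists 1; split; [lra|intros; lia]|].
      exists (Rmin d (m n)); split; [apply Rmin_glb_lt; auto using m_gt0|].
      intros k Hk; destruct (Nat.eq_dec k n) as [->|h]; [apply Rmin_r|].
      eapply Rle_trans; [apply Rmin_l|apply IH; lia]. }
    destruct Hmin as [d [Hd Hk]]; exists d; split; auto; intros x' Hx' Hdist.
    assert (Hc : Cnorm (x N - x' N)%K < d)
      by (eapply Rle_lt_trans; [apply (coord_le_dist (S N)); lia|exact Hdist]).
    rewrite <- (F x Hx), <- (F x' Hx') in Hc.
    intros k; induction k as [k IH] using (well_founded_induction Wf_nat.lt_wf).
    intro Hkn; symmetry.
    apply (branch_limit_gap y _ _ k Hy).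
    + intros j Hj; symmetry; apply IH; lia.
    + specialize (Hk k Hkn); lra.
  - intros s eps He.
    pose proof (pos_INR (S N)) as HN.
    (* Limits with the same first [n] signs share their stage [n], so each coordinate differs by at
       most [2 * delta n]; the factor 4 leaves a strict inequality. *)
    destruct (pow_half_small (eps / (4 * (INR (S N) + 1)))) as [n Hn];
      [apply Rdiv_lt_0_compat; lra|].
    specialize (Hn n (le_n _)); exists n; intros t Ht.
    apply Rle_lt_trans with ((INR (S N) + 1) * (2 * delta n)).
    + apply dist_le_coord; [pose proof (delta_gt0 n); lra|]; intros k _.
      eapply Rle_trans; [apply Cnorm_tri with (b := br y s n k)|].
      pose proof (branch_limit_close y s n k Hy).
      pose proof (branch_limit_close y t n k Hy) as Q.
      rewrite (branch_ext N E y t s n Ht), Cnorm_subC in Q; lra.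
    + pose proof (delta_le n).
      apply Rle_lt_trans with ((INR (S N) + 1) * (2 * (eps / (4 * (INR (S N) + 1))))).
      * apply Rmult_le_compat_l; lra.
      * replace ((INR (S N) + 1) * (2 * (eps / (4 * (INR (S N) + 1))))) with (eps / 2)
          by (field; lra); lra.
Qed.

End Limit.

(** * Consequences of the density of squares *)

Definition squares_dense (M : nat) (X : Vec -> Prop) : Prop :=
  forall p eps, is_poly M p -> 0 < eps ->
    exists q, is_poly M q /\ bounded_by X (fun x => p x - q x * q x)%K eps.

Lemma inP_poly (M : nat) (X : Vec -> Prop) (p : Vec -> C) : is_poly M p -> inP M X p.
Proof. apply (approx_poly Vec M X (fun x => x)). Qed.

Lemma evalP_poly (M : nat) (X : Vec -> Prop) (z : Vec) (p : Vec -> C) :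
  hull M X z -> is_poly M p -> evalP M X z p (p z).
Proof.
  intros [_ Hz] Hp eps He; exists eps; split; auto; intros q Hq Hb.
  rewrite Cnorm_subC; apply (Hz (fun x => p x - q x)%K); auto using polyB.
Qed.

(** If [p z = 0] and [p] is near [q^2], then [q z] is small, and so is the value [2 q(z) psi(q)] of
    [psi] at [q^2], because [psi] is bounded. Constants are killed by the product rule, and
    polynomials are dense. *)
Lemma squares_dense_no_derivation (M : nat) (X : Vec -> Prop) (r : R) (z : Vec)
  (psi : (Vec -> C) -> C) :
  (forall x, X x -> in_polydisc M r x) -> squares_dense M X -> hull M X z ->
  bounded_point_derivation M X z psi -> forall f, inP M X f -> psi f = C0.
Proof.
  intros Hr HS Hz [Hadd [Hscal [[K0 Hbd] Hder]]].
  (* The constant [K0] of the definition is not known to be positive. *)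
  set (K := Rabs K0 + 1).
  assert (HK : 0 < K) by (unfold K; pose proof (Rabs_pos K0); lra).
  assert (Hbd' : forall f s, inP M X f -> 0 <= s -> bounded_by X f s -> Cnorm (psi f) <= K * s).
  { intros f s Hf Hs Hb; eapply Rle_trans; [now apply (Hbd f s)|].
    apply Rmult_le_compat_r; auto; unfold K; pose proof (Rle_abs K0); lra. }
  assert (Hclose : forall f p e, inP M X f -> is_poly M p -> 0 <= e ->
    bounded_by X (fsub f p) e -> Cnorm (psi f) <= Cnorm (psi p) + K * e).
  { intros f p e Hf Hp He Hb.
    assert (Hfp : inP M X (fsub f p)).
    { apply (approx_sub Vec M X (fun x => x) r Hr); auto; now apply inP_poly. }
    replace f with (fadd p (fsub f p))
      by (apply functional_extensionality; intro; unfold fadd, fsub; ring).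
    rewrite Hadd by auto using inP_poly.
    eapply Rle_trans; [apply Cnorm_add|]; specialize (Hbd' _ e Hfp He Hb); lra. }
  assert (H1 : psi (fun _ => C1) = C0).
  { pose proof (poly_const M C1) as P1.
    pose proof (Hder _ _ _ _ (inP_poly M X _ P1) (inP_poly M X _ P1)
      (evalP_poly M X z _ Hz P1) (evalP_poly M X z _ Hz P1)) as Q.
    replace (fmul (fun _ => C1) (fun _ => C1)) with (fun _ : Vec => C1) in Q
      by (apply functional_extensionality; intro; unfold fmul; ring).
    replace (psi (fun _ => C1)) with
      (psi (fun _ => C1) * C1 + C1 * psi (fun _ => C1) - psi (fun _ => C1))%K by ring.
    rewrite <- Q; ring. }
  assert (Hc : forall c, psi (fun _ => c) = C0).
  { intro c; replace (fun _ : Vec => c) with (fmul (fun _ => c) (fun _ => C1))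
      by (apply functional_extensionality; intro; unfold fmul; ring).
    rewrite Hscal, H1 by (apply inP_poly, poly_const); ring. }
  assert (Hp0 : forall p, is_poly M p -> p z = C0 -> psi p = C0).
  { intros p Hp Hpz; apply Cnorm_close0; intros eps He.
    destruct (poly_bounded M p r Hp) as [B [HB Hb]].
    (* Replacing [p] by [q^2] costs [K * eta^2], and the product rule gives [2 * K * (B + 2) * eta];
       with [eta <= 1] the sum is at most [eta * A]. *)
    set (A := K * (2 * B + 5)).
    assert (HA : 0 < A) by (unfold A; nra).
    set (eta := Rmin 1 (eps / A)).
    assert (He0 : 0 < eta) by (apply Rmin_glb_lt; [lra|apply Rdiv_lt_0_compat; lra]).
    assert (He1 : eta <= 1) by apply Rmin_l.
    assert (He2 : eta * A <= eps).
    { replace eps with (eps / A * A) by (field; lra).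
      apply Rmult_le_compat_r; [lra|apply Rmin_r]. }
    destruct (HS p (eta * eta) Hp) as [q [Hq Hpq]]; [nra|].
    assert (Hqz : Cnorm (q z) <= eta).
    { assert (Q : Cnorm (p z - q z * q z)%K <= eta * eta).
      { apply (proj2 Hz (fun x => p x - q x * q x)%K); auto using polyB, polyM. }
      rewrite Hpz in Q; apply Cnorm_sqrt_le with (q z * q z)%K; auto; [lra|].
      replace (C0 - q z * q z)%K with (- (q z * q z))%K in Q by ring.
      now rewrite Cnorm_opp in Q. }
    assert (Hqb : bounded_by X q (B + 2)).
    { intros x Hx; apply Cnorm_sqrt_le with (q x * q x)%K; auto; [lra|].
      pose proof (Cnorm_le_add (q x * q x) (p x)) as Q; rewrite Cnorm_subC in Q.
      specialize (Hpq x Hx); specialize (Hb x (Hr x Hx)); simpl in Hpq; nra. }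
    pose proof (Hbd' q (B + 2) (inP_poly M X q Hq) ltac:(lra) Hqb) as Hpsq.
    assert (Hd := Hder q q (q z) (q z) (inP_poly M X q Hq) (inP_poly M X q Hq)
      (evalP_poly M X z q Hz Hq) (evalP_poly M X z q Hz Hq)).
    eapply Rle_trans; [apply (Hclose p (fmul q q) (eta * eta))|].
    - now apply inP_poly.
    - now apply poly_mul.
    - nra.
    - exact Hpq.
    - rewrite Hd.
      assert (Cnorm (psi q * q z + q z * psi q)%K <= 2 * (K * (B + 2) * eta)).
      { eapply Rle_trans; [apply Cnorm_add|]; rewrite !Cnorm_mul.
        pose proof (Cnorm_ge0 (psi q)); pose proof (Cnorm_ge0 (q z)).
        assert (Cnorm (psi q) * Cnorm (q z) <= K * (B + 2) * eta)
          by (apply Rmult_le_compat; auto).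
        lra. }
      unfold A in He2.
      assert (K * (eta * eta) <= K * eta) by (apply Rmult_le_compat_l; nra).
      nra. }
  intros f Hf; apply Cnorm_close0; intros eps He.
  destruct (Hf (eps / K)) as [p [Hp Hfp]]; [apply Rdiv_lt_0_compat; lra|].
  assert (Hpp : psi p = C0).
  { replace p with (fadd (fun x => p x - p z)%K (fun _ => p z))
      by (apply functional_extensionality; intro; unfold fadd; ring).
    rewrite Hadd by (apply inP_poly; auto using polyB, poly_const).
    rewrite Hc, Hp0; [ring|auto using polyB, poly_const|ring]. }
  eapply Rle_trans; [apply (Hclose f p (eps / K)); auto|].
  - apply Rlt_le, Rdiv_lt_0_compat; lra.
  - rewrite Hpp, Cnorm_0; right; field; lra.
Qed.

(** * Truncated Moebius maps and Gleason parts *)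

Fixpoint geom (c : C) (n : nat) : C :=
  match n with O => C0 | S m => (C1 + c * geom c m)%K end.

Lemma geom_spec (c : C) (n : nat) : ((C1 - c) * geom c n)%K = (C1 - Cpow c n)%K.
Proof.
  induction n as [|n IH]; simpl; [ring|].
  replace ((C1 - c) * (C1 + c * geom c n))%K with
    ((C1 - c) + c * ((C1 - c) * geom c n))%K by ring.
  rewrite IH; ring.
Qed.

Lemma geom_poly (M : nat) (p : Vec -> C) (n : nat) :
  is_poly M p -> is_poly M (fun v => geom (p v) n).
Proof. intro Hp; induction n; simpl; auto using poly_const, polyD, polyM. Qed.

(** The truncation of the Moebius map [(c - a) / (1 - a c)] of the disc. *)
Definition moebius (a : R) (n : nat) (c : C) : C :=
  ((c - RtoC a) * geom (RtoC a * c) (S n))%K.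

(** Multiplication by [1 - a c] turns the geometric sum into [1 - (a c)^(n+1)], so the bound reduces
    to [|c - a| <= |1 - a c|] on the closed disc. *)
Lemma moebius_bound (a : R) (n : nat) (c : C) : 0 < a < 1 -> Cnorm c <= 1 ->
  Cnorm (moebius a n c) <= 1 + a ^ S n.
Proof.
  intros Ha Hc; unfold moebius.
  assert (Hac : Cnorm (RtoC a * c)%K <= a).
  { rewrite Cnorm_mul, Cnorm_RtoC, Rabs_pos_eq by lra.
    pose proof (Cnorm_ge0 c); nra. }
  assert (H1 : 0 < Cnorm (C1 - RtoC a * c)%K).
  { pose proof (Cnorm_le_add C1 (RtoC a * c)) as Q; rewrite Cnorm_1 in Q; lra. }
  assert (H2 : Cnorm (c - RtoC a)%K <= Cnorm (C1 - RtoC a * c)%K).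
  { apply Rsqr_incr_0; unfold Rsqr; auto using Cnorm_ge0.
    rewrite !Cnorm_sqr; pose proof (Cnorm_sqr c) as Q; pose proof (Cnorm_ge0 c).
    assert (Q' : Re c * Re c + Im c * Im c <= 1) by nra.
    unfold Csub, Cadd, Copp, Cmul, RtoC, C1; simpl.
    (* This product is exactly [|1 - a c|^2 - |c - a|^2]. *)
    assert (0 <= (1 - a * a) * (1 - (Re c * Re c + Im c * Im c)))
      by (apply Rmult_le_pos; nra).
    nra. }
  apply Rmult_le_reg_l with (Cnorm (C1 - RtoC a * c)%K); auto.
  rewrite <- Cnorm_mul.
  replace ((C1 - RtoC a * c) * ((c - RtoC a) * geom (RtoC a * c) (S n)))%K with
    ((c - RtoC a) * ((C1 - RtoC a * c) * geom (RtoC a * c) (S n)))%K by ring.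
  rewrite geom_spec, Cnorm_mul; apply Rmult_le_compat; auto using Cnorm_ge0.
  eapply Rle_trans; [apply Cnorm_sub|]; rewrite Cnorm_1, Cnorm_pow.
  apply Rplus_le_compat_l, pow_incr; split; auto using Cnorm_ge0.
Qed.

Lemma moebius_0 (a : R) (n : nat) : moebius a n C0 = (- RtoC a)%K.
Proof.
  unfold moebius; cbn [geom].
  replace (RtoC a * C0)%K with C0 by ring; ring.
Qed.

(** [2a / (1 + a^2)] is the point that the Moebius map sends to [a]; from there on the map is at
    least [a], and truncation costs at most the factor [1 - a^(n+1)]. *)
Lemma moebius_real (a b : R) (n : nat) : 0 < a < 1 -> 2 * a / (1 + a * a) <= b <= 1 ->
  exists x, moebius a n (RtoC b) = RtoC x /\ a * (1 - a ^ S n) <= x.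
Proof.
  intros Ha [Hb1 Hb2].
  assert (Hb : 2 * a <= b * (1 + a * a)).
  { apply (Rmult_le_compat_r (1 + a * a)) in Hb1; [|nra].
    unfold Rdiv in Hb1; rewrite Rmult_assoc, Rinv_l in Hb1 by nra; lra. }
  assert (Hb0 : 0 < b) by (apply Rnot_le_lt; intro; nra).
  assert (Hab : 0 < 1 - a * b) by nra.
  assert (HP : forall k, Cpow (RtoC a * RtoC b)%K k = RtoC ((a * b) ^ k)).
  { induction k as [|k IH]; simpl; [reflexivity|]; rewrite IH; C_coords; ring. }
  exists ((b - a) * ((1 - (a * b) ^ S n) / (1 - a * b))); split.
  - unfold moebius.
    replace (geom (RtoC a * RtoC b) (S n)) with
      (RtoC ((1 - (a * b) ^ S n) / (1 - a * b))).
    + C_coords; ring.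
    + pose proof (geom_spec (RtoC a * RtoC b)%K (S n)) as Q; rewrite HP in Q.
      assert (HN : (C1 - RtoC a * RtoC b)%K = RtoC (1 - a * b)) by (C_coords; ring).
      rewrite HN in Q.
      replace (geom (RtoC a * RtoC b) (S n)) with
        (RtoC (/ (1 - a * b)) * (RtoC (1 - a * b) * geom (RtoC a * RtoC b) (S n)))%K.
      * rewrite Q; C_coords; field; lra.
      * replace (RtoC (/ (1 - a * b)) * (RtoC (1 - a * b) * geom (RtoC a * RtoC b) (S n)))%K
          with ((RtoC (/ (1 - a * b)) * RtoC (1 - a * b)) * geom (RtoC a * RtoC b) (S n))%K
          by ring.
        replace (RtoC (/ (1 - a * b)) * RtoC (1 - a * b))%K with C1
          by (C_coords; field; lra); ring.
  - assert (Hr : a <= (b - a) / (1 - a * b)).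
    { apply Rmult_le_reg_r with (1 - a * b); auto.
      unfold Rdiv; rewrite Rmult_assoc, Rinv_l by lra; nra. }
    assert (Hp : (a * b) ^ S n <= a ^ S n) by (apply pow_incr; split; nra).
    assert (Hp1 : a ^ S n <= 1).
    { replace 1 with (1 ^ S n) by apply pow1; apply pow_incr; lra. }
    replace ((b - a) * ((1 - (a * b) ^ S n) / (1 - a * b))) with
      ((b - a) / (1 - a * b) * (1 - (a * b) ^ S n)) by (field; lra).
    apply Rmult_le_compat; lra.
Qed.

(** If [rho] is the supremum of [|h w|] over [|h| <= 1], [h z = 0], replacing
    [h] by an approximate square root shows [rho <= rho^2]. *)
Lemma squares_dense_separates (M : nat) (X : Vec -> Prop) (r : R) (z w : Vec) (eta : R) :
  (forall x, X x -> in_polydisc M r x) -> squares_dense M X ->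
  hull M X z -> hull M X w -> z <> w -> 0 < eta ->
  exists h, is_poly M h /\ bounded_by X h 1 /\ h z = C0 /\ 1 - eta < Cnorm (h w).
Proof.
  intros Hr HS Hz Hw Hzw Heta.
  pose (T := fun b => exists h, is_poly M h /\ bounded_by X h 1 /\ h z = C0 /\ Cnorm (h w) = b).
  assert (Hk : exists k, (k < M)%nat /\ z k <> w k).
  { apply NNPP; intro Hno; apply Hzw, functional_extensionality; intro k.
    destruct (Nat.lt_ge_cases k M) as [h|h].
    - apply NNPP; intro; apply Hno; eauto.
    - now rewrite (proj1 Hz k h), (proj1 Hw k h). }
  destruct Hk as [k [Hk Hne]].
  assert (T0 : exists b, T b /\ 0 < b).
  { set (B := Rabs r + Cnorm (z k) + 1).
    assert (HB : 0 < B).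
    { unfold B; pose proof (Rabs_pos r); pose proof (Cnorm_ge0 (z k)); lra. }
    exists (Cnorm (RtoC (/ B) * (w k - z k))%K); split.
    - exists (fun v => RtoC (/ B) * (v k - z k))%K; split; [|split; [|split]].
      + auto using polyM, polyB, poly_const, poly_coord.
      + intros x Hx; specialize (Hr x Hx k Hk).
        rewrite Cnorm_mul, Cnorm_RtoC, Rabs_pos_eq
          by (apply Rlt_le, Rinv_0_lt_compat; lra).
        apply Rmult_le_reg_l with B; auto.
        rewrite <- Rmult_assoc, Rinv_r by lra.
        pose proof (Cnorm_sub (x k) (z k)); pose proof (Rle_abs r); unfold B; lra.
      + ring.
      + reflexivity.
    - rewrite Cnorm_mul, Cnorm_RtoC; apply Rmult_lt_0_compat.
      + apply Rabs_pos_lt, Rinv_neq_0_compat; lra.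
      + apply Cnorm_gt0; intro Q; apply Hne; symmetry; now apply Csub_eq0. }
  assert (T1 : is_upper_bound T 1).
  { intros b [h [Hh [Hb [_ <-]]]]; now apply (proj2 Hw h). }
  destruct (completeness T) as [rho [Hub Hlub]].
  - now exists 1.
  - destruct T0 as [b [Hb _]]; eauto.
  - destruct T0 as [b0 [Hb0 Hb0']].
    assert (Hrho : 0 < rho <= 1) by (split; [specialize (Hub b0 Hb0); lra|now apply Hlub]).
    assert (Hsq : is_upper_bound T (rho * rho)).
    { intros b [h [Hh [Hhb [Hhz <-]]]]; apply Rle_plus_epsilon; intros e He.
      (* With this [t] the final bound [(rho + 3t)^2 + t^2] is at most [rho^2 + 16t], since [rho]
         and [t] are at most 1. *)
      set (t := Rmin 1 (e / 16)).
      assert (Ht0 : 0 < t) by (apply Rmin_glb_lt; lra).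
      assert (Ht1 : t <= 1) by apply Rmin_l.
      assert (Ht2 : 16 * t <= e).
      { assert (t <= e / 16) by apply Rmin_r; lra. }
      destruct (HS h (t * t) Hh) as [q [Hq Hhq]]; [nra|].
      assert (Hqb : bounded_by X q (1 + t)).
      { intros x Hx; apply Cnorm_sqrt_le with (q x * q x)%K; auto; [lra|].
        pose proof (Cnorm_le_add (q x * q x) (h x)) as Q; rewrite Cnorm_subC in Q.
        specialize (Hhq x Hx); specialize (Hhb x Hx); simpl in Hhq; nra. }
      assert (Hqz : Cnorm (q z) <= t).
      { assert (Q : Cnorm (h z - q z * q z)%K <= t * t)
          by (apply (proj2 Hz (fun x => h x - q x * q x)%K); auto using polyB, polyM).
        rewrite Hhz in Q; apply Cnorm_sqrt_le with (q z * q z)%K; auto; [lra|].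
        replace (C0 - q z * q z)%K with (- (q z * q z))%K in Q by ring.
        now rewrite Cnorm_opp in Q. }
      assert (Hhw : Cnorm (h w - q w * q w)%K <= t * t)
        by (apply (proj2 Hw (fun x => h x - q x * q x)%K); auto using polyB, polyM).
      assert (Hinv : 0 < / (1 + 2 * t)) by (apply Rinv_0_lt_compat; lra).
      (* Subtracting [q z] restores the zero at [z] and raises the bound on [X] from [1 + t] to at
         most [1 + 2t]. *)
      assert (HT : T (/ (1 + 2 * t) * Cnorm (q w - q z)%K)).
      { exists (fun v => RtoC (/ (1 + 2 * t)) * (q v - q z))%K; split; [|split; [|split]].
        - auto using polyM, polyB, poly_const.
        - intros x Hx; rewrite Cnorm_mul, Cnorm_RtoC, Rabs_pos_eq by lra.
          apply Rmult_le_reg_l with (1 + 2 * t); [lra|].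
          rewrite <- Rmult_assoc, Rinv_r by lra.
          pose proof (Cnorm_sub (q x) (q z)); specialize (Hqb x Hx); lra.
        - ring.
        - rewrite Cnorm_mul, Cnorm_RtoC, Rabs_pos_eq by lra; reflexivity. }
      specialize (Hub _ HT).
      assert (Hqw : Cnorm (q w - q z)%K <= rho * (1 + 2 * t)).
      { apply Rmult_le_reg_l with (/ (1 + 2 * t)); auto.
        eapply Rle_trans; [exact Hub|right; field; lra]. }
      pose proof (Cnorm_le_add (q w) (q w - q z)%K) as Q1.
      replace (q w - (q w - q z))%K with (q z) in Q1 by ring.
      assert (Q2 : Cnorm (q w) <= rho + 3 * t) by nra.
      pose proof (Cnorm_le_add (h w) (q w * q w)) as Q3; rewrite Cnorm_mul in Q3.
      pose proof (Cnorm_ge0 (q w)).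
      assert (Cnorm (q w) * Cnorm (q w) <= (rho + 3 * t) * (rho + 3 * t))
        by (apply Rmult_le_compat; lra).
      nra. }
    (* From [0 < rho <= rho^2] follows [rho >= 1], so [1 - eta] cannot be an upper bound. *)
    pose proof (Hlub _ Hsq).
    apply NNPP; intro Hno.
    assert (Hub' : is_upper_bound T (1 - eta)).
    { intros b [h [Hh [Hb [Hhz <-]]]]; apply Rnot_lt_le; intro Hlt.
      apply Hno; exists h; auto. }
    apply Hlub in Hub'; nra.
Qed.

(** A function of norm at most 1 can vanish at [z] and be nearly unimodular at [w]. After a
    rotation, a Moebius map sends the value at [z] to [-a] and the value at [w] beyond [a], up to
    truncation; as [a] may be taken close to 1, no bound below 2 survives. *)
Lemma squares_dense_one_point_part (M : nat) (X : Vec -> Prop) (r : R) (z : Vec) :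
  (forall x, X x -> in_polydisc M r x) -> squares_dense M X -> hull M X z ->
  one_point_part M X z.
Proof.
  intros Hr HS Hz w Hw [rr [Hrr Hg]]; apply NNPP; intro Hne.
  (* [2 a] is at least the midpoint of [rr] and 2; the maximum with 1/2 keeps [a] positive for every
     [rr]. *)
  set (a := Rmax (1 / 2) ((rr + 2) / 4)).
  assert (Ha1 : 1 / 2 <= a) by apply Rmax_l.
  assert (Ha2 : (rr + 2) / 4 <= a) by apply Rmax_r.
  assert (Ha : 0 < a < 1) by (split; [lra|apply Rmax_lub_lt; lra]).
  (* Truncation and normalisation cost at most three times this power, which is less than
     [(2 - rr) / 2]. *)
  destruct (pow_lt_1_zero a) with (y := (2 - rr) / 8) as [n Hn];
    [rewrite Rabs_pos_eq; lra|lra|].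
  specialize (Hn (S n) ltac:(lia)); rewrite Rabs_pos_eq in Hn by (apply pow_le; lra).
  assert (Hfrac : 2 * a / (1 + a * a) < 1).
  { apply Rmult_lt_reg_r with (1 + a * a); [nra|].
    unfold Rdiv; rewrite Rmult_assoc, Rinv_l by nra; nra. }
  destruct (squares_dense_separates M X r z w (1 - 2 * a / (1 + a * a)))
    as [h [Hh [Hhb [Hhz Hhw]]]]; auto; [lra|].
  set (b := Cnorm (h w)) in *.
  assert (Hb1 : b <= 1) by now apply (proj2 Hw h).
  assert (Hb0 : 0 < b).
  { assert (0 < 2 * a / (1 + a * a)) by (apply Rdiv_lt_0_compat; nra); lra. }
  assert (Hwn : h w <> C0) by now apply Cnorm_neq0.
  (* The rotation that makes the value at [w] real and positive, as [moebius_real] requires. *)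
  set (th := (RtoC b * Cinv (h w))%K).
  assert (Hth : Cnorm th = 1).
  { unfold th; rewrite Cnorm_mul, Cnorm_RtoC, Cnorm_inv, Rabs_pos_eq by (auto || lra).
    fold b; field; lra. }
  destruct (moebius_real a b n Ha) as [x [Hx1 Hx2]]; [lra|].
  set (A := a ^ S n) in *.
  assert (HA : 0 < A) by (apply pow_lt; lra).
  set (f := fun v => (RtoC (/ (1 + A)) * moebius a n (th * h v))%K).
  assert (Hf : is_poly M f).
  { unfold f, moebius; apply polyM; [apply poly_const|]; apply polyM.
    - auto using polyB, polyM, poly_const.
    - apply (geom_poly M (fun v => RtoC a * (th * h v))%K); auto using polyM, poly_const. }
  assert (Hfb : bounded_by X f 1).
  { intros v Hv; unfold f.
    rewrite Cnorm_mul, Cnorm_RtoC, Rabs_pos_eq by (apply Rlt_le, Rinv_0_lt_compat; lra).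
    apply Rmult_le_reg_l with (1 + A); [lra|]; rewrite <- Rmult_assoc, Rinv_r by lra.
    rewrite Rmult_1_l, Rmult_1_r; apply moebius_bound; auto.
    rewrite Cnorm_mul, Hth; specialize (Hhb v Hv); lra. }
  specialize (Hg f (inP_poly M X f Hf) Hfb _ _ (evalP_poly M X z f Hz Hf)
    (evalP_poly M X w f Hw Hf)).
  assert (Hrr0 : 0 <= rr) by (pose proof (Cnorm_ge0 (f z - f w)%K); lra).
  assert (Hfz : f z = RtoC (/ (1 + A) * - a)).
  { unfold f; rewrite Hhz; replace (th * C0)%K with C0 by ring; rewrite moebius_0.
    C_coords; ring. }
  assert (Hfw : f w = RtoC (/ (1 + A) * x)).
  { unfold f; replace (th * h w)%K with (RtoC b) by (unfold th; field; auto).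
    rewrite Hx1; C_coords; ring. }
  rewrite Hfz, Hfw in Hg.
  replace (RtoC (/ (1 + A) * - a) - RtoC (/ (1 + A) * x))%K with
    (RtoC (- (/ (1 + A) * (a + x)))) in Hg by (C_coords; ring).
  assert (Hx0 : 0 <= x).
  { eapply Rle_trans; [|exact Hx2]; apply Rmult_le_pos; lra. }
  rewrite Cnorm_RtoC, Rabs_Ropp, Rabs_pos_eq in Hg
    by (apply Rmult_le_pos; [apply Rlt_le, Rinv_0_lt_compat|]; lra).
  assert (Hg' : a + x <= rr * (1 + A)).
  { replace (a + x) with (/ (1 + A) * (a + x) * (1 + A)) by (field; lra).
    apply Rmult_le_compat_r; lra. }
  assert (a * A <= A) by nra.
  assert (rr * A <= 2 * A) by nra.
  nra.
Qed.

(** * Compactness in C^M *)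

Lemma compact_coord_bounded (M k : nat) (X : Vec -> Prop) : compactN M X -> (k < M)%nat ->
  exists B, forall x, X x -> Cnorm (x k) <= B.
Proof.
  intros [_ HX] Hk.
  destruct (HX nat (fun n v => Cnorm (v k) < INR n)) as [l Hl].
  - intros n v _ Hv; exists (INR n - Cnorm (v k)); split; [lra|]; intros w _ Hd.
    pose proof (coord_le_dist M k v w Hk) as Q; rewrite Cnorm_subC in Q.
    pose proof (Cnorm_le_add (w k) (v k)); lra.
  - intros v _; destruct (INR_unbounded (Cnorm (v k))) as [n Hn]; exists n; lra.
  - exists (INR (list_max l)); intros x Hx; destruct (Hl x Hx) as [n [Hn Hb]].
    assert (n <= list_max l)%nat.
    { pose proof (proj1 (list_max_le l (list_max l)) (le_n _)) as F.
      rewrite Forall_forall in F; auto. }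
    apply le_INR in H; lra.
Qed.

Lemma compact_polydisc (M : nat) (X : Vec -> Prop) : compactN M X ->
  exists r, forall x, X x -> in_polydisc M r x.
Proof.
  intro HX; assert (H : forall L, (L <= M)%nat ->
    exists r, forall x, X x -> in_polydisc L r x).
  { induction L as [|L IH]; intro h.
    - exists 0; intros x _ k Hk; lia.
    - destruct IH as [r Hr]; [lia|].
      destruct (compact_coord_bounded M L X HX h) as [B HB].
      exists (Rmax r B); intros x Hx; apply in_polydisc_S; auto. }
  now apply H.
Qed.

Lemma vec_polydisc (M : nat) (v : Vec) : exists r, in_polydisc M r v.
Proof.
  induction M as [|M [r Hr]]; [exists 0; intros k Hk; lia|].
  exists (Rmax r (Cnorm (v M))); apply in_polydisc_S; auto; lra.
Qed.

Definition closed_at (M : nat) (X : Vec -> Prop) (v : Vec) : Prop :=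
  exists e, 0 < e /\ forall w, X w -> ~ forall k, (k < M)%nat -> Cnorm (w k - v k)%K < e.

Lemma compact_closed (M : nat) (X : Vec -> Prop) (v : Vec) :
  compactN M X -> inCN M v -> ~ X v -> closed_at M X v.
Proof.
  intros [HX1 HX] Hv Hn.
  destruct (HX nat (fun n w => exists k, (k < M)%nat /\ / INR (S n) < Cnorm (w k - v k)%K))
    as [l Hl].
  - intros n w _ [k [Hk Hw]]; exists (Cnorm (w k - v k)%K - / INR (S n)); split; [lra|].
    intros w' _ Hd; exists k; split; auto.
    pose proof (coord_le_dist M k w w' Hk); pose proof (Cnorm_tri (w k) (w' k) (v k)); lra.
  - intros w Hw.
    assert (Hk : exists k, (k < M)%nat /\ w k <> v k).
    { apply NNPP; intro Hno; apply Hn; replace v with w; auto.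
      apply functional_extensionality; intro k.
      destruct (Nat.lt_ge_cases k M) as [h|h].
      - apply NNPP; intro; apply Hno; eauto.
      - now rewrite (Hv k h), (HX1 w Hw k h). }
    destruct Hk as [k [Hk Hne]].
    assert (Hpos : 0 < Cnorm (w k - v k)%K)
      by (apply Cnorm_gt0; intro Q; apply Hne; now apply Csub_eq0).
    destruct (INR_unbounded (/ Cnorm (w k - v k)%K)) as [n Hnn]; exists n, k; split; auto.
    rewrite <- (Rinv_inv (Cnorm (w k - v k)%K)).
    pose proof (Rinv_0_lt_compat _ Hpos); rewrite S_INR.
    apply Rinv_lt_contravar; [apply Rmult_lt_0_compat|]; lra.
  - exists (/ INR (S (list_max l))); split.
    + apply Rinv_0_lt_compat, lt_0_INR; lia.
    + intros w Hw Hall; destruct (Hl w Hw) as [n [Hin [k [Hk Hlt]]]].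
      specialize (Hall k Hk).
      assert (n <= list_max l)%nat.
      { pose proof (proj1 (list_max_le l (list_max l)) (le_n _)) as F.
        rewrite Forall_forall in F; auto. }
      assert (/ INR (S (list_max l)) <= / INR (S n)).
      { apply Rinv_le_contravar; [apply lt_0_INR; lia|apply le_INR; lia]. }
      lra.
Qed.

Lemma hull_closed (M : nat) (X : Vec -> Prop) (v : Vec) :
  inCN M v -> ~ hull M X v -> closed_at M (hull M X) v.
Proof.
  intros Hv Hn.
  assert (Hp : exists p B, is_poly M p /\ bounded_by X p B /\ B < Cnorm (p v)).
  { apply NNPP; intro Hno; apply Hn; split; auto; intros p Hp B HB.
    apply Rnot_lt_le; intro; apply Hno; eauto. }
  destruct Hp as [p [B [Hp [HB Hlt]]]]; destruct (vec_polydisc M v) as [r Hr].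
  destruct (poly_unif_cont M p r ((Cnorm (p v) - B) / 2) Hp) as [d [Hd Hc]]; [lra|].
  exists d; split; auto; intros w [_ Hw] Hall.
  assert (Cnorm (p w - p v)%K <= (Cnorm (p v) - B) / 2)
    by (apply Hc; auto; intros k Hk; specialize (Hall k Hk); lra).
  specialize (Hw p Hp B HB); pose proof (Cnorm_le_add (p v) (p w)) as Q.
  rewrite Cnorm_subC in Q; lra.
Qed.

Fixpoint tget (n : nat) : Compactness.Tn n R -> nat -> R :=
  match n with
  | O => fun _ _ => 0
  | S n' => fun t k => match k with O => fst t | S k' => tget n' (snd t) k' end
  end.

Fixpoint tmake (n : nat) (f : nat -> R) : Compactness.Tn n R :=
  match n with
  | O => tt
  | S n' => (f 0%nat, tmake n' (fun k => f (S k)))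
  end.

Lemma tget_tmake n f k : (k < n)%nat -> tget n (tmake n f) k = f k.
Proof.
  revert f k; induction n as [|n IH]; intros f k h; [lia|]; simpl.
  destruct k; simpl; auto; apply (IH (fun k => f (S k))); lia.
Qed.

Lemma bounded_tmake n r f : (forall k, (k < n)%nat -> Rabs (f k) <= r) ->
  Compactness.bounded_n n (tmake n (fun _ => - r)) (tmake n (fun _ => r)) (tmake n f).
Proof.
  revert f; induction n as [|n IH]; intros f H; simpl; auto; split.
  - specialize (H 0%nat ltac:(lia)); pose proof (Rle_abs (f 0%nat)).
    pose proof (Rle_abs (- f 0%nat)) as H'; rewrite Rabs_Ropp in H'; lra.
  - apply IH; intros k Hk; apply H; lia.
Qed.

Lemma close_tget n d x t k : Compactness.close_n n d x t -> (k < n)%nat ->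
  Rabs (tget n x k - tget n t k) < d.
Proof.
  revert x t k; induction n as [|n IH]; intros x t k H h; [lia|].
  destruct x as [x1 x2], t as [t1 t2]; destruct H as [H1 H2].
  destruct k; simpl; auto; apply IH; auto; lia.
Qed.

Definition vec_of (M : nat) (f : nat -> R) : Vec :=
  fun k => if Nat.ltb k M then mkC (f (2 * k)%nat) (f (2 * k + 1)%nat) else C0.

Definition coords_of (v : Vec) (j : nat) : R :=
  if Nat.even j then Re (v (Nat.div2 j)) else Im (v (Nat.div2 j)).

Lemma coords_even v k : coords_of v (2 * k) = Re (v k).
Proof.
  unfold coords_of; rewrite Nat.even_mul, Nat.div2_double; reflexivity.
Qed.

Lemma coords_odd v k : coords_of v (2 * k + 1) = Im (v k).
Proof.
  unfold coords_of; rewrite Nat.add_1_r, Nat.even_succ, Nat.odd_mul, Nat.div2_succ_double.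
  reflexivity.
Qed.

(** Heine-Borel by a gauge on a real box of dimension [2 * M]: each point gets a radius within which
    either one member of the cover contains all of [X], or [X] has no point. Finitely many such
    neighbourhoods cover the box. *)
Lemma closed_polydisc_compact (M : nat) (X : Vec -> Prop) (r : R) :
  (forall x, X x -> inCN M x) -> (forall x, X x -> in_polydisc M r x) ->
  (forall v, inCN M v -> ~ X v -> closed_at M X v) -> compactN M X.
Proof.
  intros HX Hr Hcl; split; auto; intros I U HU Hcov.
  (* Real and imaginary parts closer than [d] give a complex distance below [2 * d]. *)
  pose (near := fun v d w => forall k, (k < M)%nat -> Cnorm (w k - v k)%K < 2 * d).
  pose (good := fun v d => 0 < d /\
    ((exists i, forall w, X w -> near v d w -> U i w) \/ (forall w, X w -> ~ near v d w))).
  assert (Hgood : forall v, inCN M v -> exists d, good v d).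
  { intros v Hv; destruct (classic (X v)) as [Hx|Hx].
    - destruct (Hcov v Hx) as [i Hi]; destruct (HU i v Hv Hi) as [e [He Hu]].
      pose proof (pos_INR M).
      assert (Hd : 0 < e / (4 * (INR M + 1))) by (apply Rdiv_lt_0_compat; lra).
      exists (e / (4 * (INR M + 1))); split; auto; left; exists i; intros w Hw Hnear.
      apply Hu; auto.
      apply Rle_lt_trans with ((INR M + 1) * (2 * (e / (4 * (INR M + 1))))).
      + apply dist_le_coord; [lra|]; intros k Hk; rewrite Cnorm_subC.
        specialize (Hnear k Hk); lra.
      + replace ((INR M + 1) * (2 * (e / (4 * (INR M + 1))))) with (e / 2) by (field; lra).
        lra.
    - destruct (Hcl v Hv Hx) as [e [He Hne]]; exists (e / 2); split; [lra|right].
      intros w Hw Hnear; apply (Hne w Hw); intros k Hk; specialize (Hnear k Hk); lra. }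
  assert (Hvec : forall f, inCN M (vec_of M f)).
  { intros f k Hk; unfold vec_of; now rewrite (proj2 (Nat.ltb_ge k M)). }
  pose (toV := fun t => vec_of M (tget (2 * M) t)).
  pose (gauge := fun t => proj1_sig (constructive_indefinite_description _
    (Hgood (toV t) (Hvec _)))).
  assert (Hgauge : forall t, good (toV t) (gauge t)) by (intro; unfold gauge; apply proj2_sig).
  pose proof (Compactness.compactness_list (2 * M) (tmake _ (fun _ => - r))
    (tmake _ (fun _ => r)) (fun t => mkposreal _ (proj1 (Hgauge t)))) as HL.
  apply NNPP in HL; destruct HL as [l Hl].
  assert (HI : exists li, forall t, In t l ->
    (exists i, forall w, X w -> near (toV t) (gauge t) w -> U i w) ->
    exists i, In i li /\ forall w, X w -> near (toV t) (gauge t) w -> U i w).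
  { clear Hl; induction l as [|t l [li IH]]; [exists nil; simpl; tauto|].
    destruct (classic (exists i, forall w, X w -> near (toV t) (gauge t) w -> U i w))
      as [[i Hi]|Hno].
    - exists (i :: li); intros t' [<-|Ht'] Hex; [exists i; simpl; auto|].
      destruct (IH t' Ht' Hex) as [i' [H1 H2]]; exists i'; simpl; auto.
    - exists li; intros t' [<-|Ht'] Hex; [contradiction|auto]. }
  destruct HI as [li Hli]; exists li; intros x Hx.
  destruct (Hl (tmake (2 * M) (coords_of x))) as [t [Ht [_ Hclose]]].
  { apply bounded_tmake; intros j Hj; unfold coords_of.
    assert (Hdj : (Nat.div2 j < M)%nat).
    { rewrite Nat.div2_div; apply Nat.Div0.div_lt_upper_bound; lia. }
    specialize (Hr x Hx _ Hdj).
    pose proof (Re_le_Cnorm (x (Nat.div2 j))); pose proof (Im_le_Cnorm (x (Nat.div2 j))).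
    destruct (Nat.even j); lra. }
  change (Compactness.close_n (2 * M) (gauge t) (tmake (2 * M) (coords_of x)) t) in Hclose.
  assert (Hnear : near (toV t) (gauge t) x).
  { intros k Hk; unfold toV, vec_of; rewrite (proj2 (Nat.ltb_lt k M) Hk).
    pose proof (close_tget _ _ _ _ (2 * k) Hclose ltac:(lia)) as H1.
    pose proof (close_tget _ _ _ _ (2 * k + 1) Hclose ltac:(lia)) as H2.
    rewrite tget_tmake in H1, H2 by lia; rewrite coords_even in H1; rewrite coords_odd in H2.
    eapply Rle_lt_trans; [apply Cnorm_le_ReIm|].
    unfold Csub, Cadd, Copp; cbn [Re Im]; unfold Rminus in *; lra. }
  destruct (Hgauge t) as [_ [Hex|Hno]].
  - destruct (Hli t Ht Hex) as [i [H1 H2]]; exists i; auto.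
  - exfalso; apply (Hno x Hx Hnear).
Qed.

(** * The hull as first stage of the tower *)

Lemma poly_drop_last (N : nat) (p : Vec -> C) : is_poly (S N) p ->
  exists q, is_poly N q /\ forall v, inCN N v -> p v = q v.
Proof.
  induction 1 as [c|k Hk|p q _ [p' [Hp' Ep]] _ [q' [Hq' Eq]]|p q _ [p' [Hp' Ep]] _ [q' [Hq' Eq]]].
  - exists (fun _ => c); split; [apply poly_const|auto].
  - destruct (Nat.eq_dec k N) as [->|h].
    + exists (fun _ => C0); split; [apply poly_const|]; intros v Hv; now apply Hv.
    + exists (fun v => v k); split; auto; apply poly_coord; lia.
  - exists (fadd p' q'); split; [now apply poly_add|].
    intros v Hv; unfold fadd; now rewrite Ep, Eq.
  - exists (fmul p' q'); split; [now apply poly_mul|].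
    intros v Hv; unfold fmul; now rewrite Ep, Eq.
Qed.

Lemma hull_self (M : nat) (X : Vec -> Prop) (x : Vec) :
  (forall v, X v -> inCN M v) -> X x -> hull M X x.
Proof. intros HX Hx; split; auto; intros p _ B HB; now apply HB. Qed.

Lemma hull_polydisc (M : nat) (X : Vec -> Prop) (r : R) (z : Vec) :
  (forall x, X x -> in_polydisc M r x) -> hull M X z -> in_polydisc M r z.
Proof.
  intros Hr Hz k Hk; apply (proj2 Hz (fun v => v k)); [now apply poly_coord|].
  intros x Hx; now apply Hr.
Qed.

Lemma proj_poly (N : nat) (p : Vec -> C) (v : Vec) : is_poly N p -> p (proj N v) = p v.
Proof.
  intro Hp; apply poly_ext with N; auto; intros k Hk; unfold proj.
  now rewrite (proj2 (Nat.ltb_lt k N) Hk).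
Qed.

(** At height 0 the constant 0 recovers the last coordinate whatever the perturbation, so even the
    tolerance 1 is admissible. *)
Lemma good_stage_hull (N : nat) (Y : Vec -> Prop) (r0 : R) :
  (forall y, Y y -> in_polydisc N r0 y) -> dense_invertibles N Y ->
  good_stage N r0 (hull N Y) 1.
Proof.
  intros Hr HDI; split; [lra|]; split; [|split].
  - intros x Hx; split; [|split].
    + intros k Hk; apply (proj1 Hx); lia.
    + now apply hull_polydisc with Y.
    + rewrite (proj1 Hx N (le_n _)), Cnorm_0; lra.
  - intros eps He; exists (fun _ => C0); split; [apply poly_const|].
    intros [x t] [Hx _]; cbn [fst] in Hx |- *; rewrite (proj1 Hx N (le_n _)).
    replace (C0 - C0)%K with C0 by ring; rewrite Cnorm_0; lra.
  - apply dense_invertibles_poly with (r := r0) in HDI; auto.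
    assert (HH : poly_dense_invertibles N (hull N Y)).
    { apply poly_dense_invertibles_dominates with Y; auto.
      intros p Hp B HB x Hx; now apply (proj2 Hx). }
    intros p Hp eps He; destruct (poly_drop_last N p Hp) as [p' [Hp' Ep]].
    destruct (HH p' Hp' eps He) as [q [s [Hq [Hs [Ha Hb]]]]]; exists q, s.
    split; [|split; [|split]]; auto.
    + now apply poly_weaken with N; [lia|].
    + now apply poly_weaken with N; [lia|].
    + intros x Hx; rewrite Ep by apply Hx; auto.
Qed.

Theorem theorem7p6 (N : nat) (Y : Vec -> Prop) :
  compactN N Y ->
  (exists y, hull N Y y /\ ~ Y y) ->
  dense_invertibles N Y ->
  exists X : Vec -> Prop,
    compactN (S N) X /\
    (* (i) pi(X) = Y *)
    (forall y, Y y <-> exists x, X x /\ proj N x = y) /\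
    (* (ii) pi(hat X \ X) = hat Y \ Y *)
    (forall y, (hull N Y y /\ ~ Y y) <->
               exists x, hull (S N) X x /\ ~ X x /\ proj N x = y) /\
    (* (iii) *)
    dense_invertibles (S N) X /\
    (* (iv) *)
    (forall z, hull (S N) X z -> one_point_part (S N) X z) /\
    (forall z psi, hull (S N) X z -> bounded_point_derivation (S N) X z psi ->
       forall f, inP (S N) X f -> psi f = C0) /\
    (* (v) *)
    (forall z, hull N Y z ->
       is_cantor (S N) (fun x => hull (S N) X x /\ proj N x = z)).
Proof.
  intros HY _ HDI; destruct (compact_polydisc N Y HY) as [r0 Hr0].
  destruct (tower_exists N r0 (fun n => peval (S N) (penum n)) (hull N Y) 1)
    as [Hs [E [m [delta [Hs0 [Hd0 Htower]]]]]].
  { intro; apply peval_poly. }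
  { now apply good_stage_hull. }
  set (H0 := hull N Y) in *.
  assert (HC : forall y, H0 y -> inCN N y) by (intros y Hy; apply Hy).
  assert (HYH : forall y, Y y -> H0 y).
  { intros y Hy; apply hull_self; auto; apply HY. }
  set (L := branch_limit N E delta); set (X := limit_set N E delta Y).
  set (Xh := limit_set N E delta H0).
  assert (Hproj : forall y s, H0 y -> proj N (L y s) = y)
    by (intros y s Hy; eapply proj_branch_limit; eauto).
  assert (HXXh : forall x, X x -> Xh x)
    by (intros x [y [s [Hy ->]]]; exists y, s; auto).
  assert (Hbd : forall x, Xh x -> in_polydisc (S N) (limit_radius r0) x).
  { intros x [y [s [Hy ->]]]; eapply branch_limit_polydisc; eauto. }
  assert (HinC : forall x, Xh x -> inCN (S N) x).
  { intros x [y [s [Hy ->]]]; eapply branch_limit_inCN; eauto. }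
  assert (HXY : forall x, Xh x -> Y (proj N x) -> X x).
  { intros x [y [s [Hy ->]]] HYp; fold (L y s) in HYp |- *.
    rewrite Hproj in HYp by auto; exists y, s; auto. }
  assert (Hdom : dominates (S N) X Xh).
  { eapply limit_dominates; eauto.
    intros p Hp B HB y Hy; destruct (poly_drop_last N p Hp) as [q [Hq Eq]].
    rewrite Eq by now apply HC.
    apply (proj2 Hy q Hq); intros x Hx; rewrite <- Eq by now apply HC, HYH.
    now apply HB. }
  (* One inclusion is [limit_hull], once [z] is seen to project into the hull of [Y]; the other is
     domination. *)
  assert (Hhull : forall z, hull (S N) X z <-> Xh z).
  { intro z; split.
    - intro Hz; eapply limit_hull; eauto.
      + split; [apply Hz|]; intros p Hp B HB; apply (proj2 Hz p Hp).
        intros x Hx; now apply HB, HXXh.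
      + split; [intros k Hk; unfold proj; now rewrite (proj2 (Nat.ltb_ge k N) Hk)|].
        intros p Hp B HB; rewrite proj_poly by auto.
        apply (proj2 Hz p); [apply poly_weaken with N; auto|].
        intros x [y [s [Hy ->]]]; fold (L y s).
        rewrite <- (proj_poly N p) by auto; rewrite Hproj by auto; now apply HB.
    - intro Hz; split; auto; intros p Hp B HB; now apply (Hdom p Hp B HB). }
  assert (Hbd' : forall x, X x -> in_polydisc (S N) (limit_radius r0) x) by auto.
  assert (Hsq : squares_dense (S N) X).
  { intros p eps Hp He.
    destruct (limit_squares_dense N r0 H0 Hs E m delta Hs0 Hd0 Htower p eps Hp He)
      as [q [Hq Hpq]].
    exists q; split; auto; intros x Hx; apply Hpq, HXXh, Hx. }
  exists X; split; [|split; [|split; [|split; [|split; [|split]]]]].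
  - apply closed_polydisc_compact with (limit_radius r0); auto.
    (* A point missing from [X] either lies in the hull and projects outside the closed set [Y], or
       lies outside the closed hull. *)
    intros v Hv Hn; destruct (classic (hull (S N) X v)) as [Hh|Hh].
    + assert (HnY : ~ Y (proj N v)) by (intro; apply Hn, HXY; auto; now apply Hhull).
      assert (HCv : inCN N (proj N v))
        by (intros k Hk; unfold proj; now rewrite (proj2 (Nat.ltb_ge k N) Hk)).
      destruct (compact_closed N Y (proj N v) HY HCv HnY) as [e [He Hcl]].
      exists e; split; auto; intros w [y [s [Hy ->]]] Hall; fold (L y s) in Hall.
      apply (Hcl y Hy); intros k Hk; specialize (Hall k ltac:(lia)).
      rewrite <- (Hproj y s) by auto; unfold proj.
      now rewrite (proj2 (Nat.ltb_lt k N) Hk).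
    + destruct (hull_closed (S N) X v Hv Hh) as [e [He Hcl]].
      exists e; split; auto; intros w Hw; apply Hcl; apply Hhull; auto.
  - intro y; split.
    + intro Hy; exists (L y (fun _ => true)); split; [exists y, (fun _ => true); auto|].
      apply Hproj; auto.
    + intros [x [[y' [s [Hy' ->]]] <-]]; fold (L y' s); rewrite Hproj; auto.
  - intro y; split.
    (* Any sign sequence would do: a point of the hull belongs to [X] exactly when its projection
       belongs to [Y]. *)
    + intros [Hy HnY]; exists (L y (fun _ => true)); split; [|split].
      * apply Hhull; exists y, (fun _ => true); auto.
      * intros [y' [s [Hy' Eq]]]; apply HnY.
        rewrite <- (Hproj y (fun _ => true)) by auto.
        rewrite Eq; fold (L y' s); rewrite Hproj; auto.
      * now apply Hproj.
    + intros [x [Hx [HnX <-]]]; apply Hhull in Hx; split; auto.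
      destruct Hx as [y [s [Hy ->]]]; fold (L y s); rewrite Hproj; auto.
  - apply poly_dense_invertibles_dense with (limit_radius r0); auto.
    intros p Hp eps He.
    destruct (limit_dense_invertibles N r0 H0 Hs E m delta Hs0 Hd0 Htower p Hp eps He)
      as [q [s [Hq [Hs' [Ha Hb]]]]].
    exists q, s; split; [|split; [|split]]; auto; intros x Hx.
    + apply Ha, HXXh, Hx.
    + apply Hb, HXXh, Hx.
  - intros z Hz; apply squares_dense_one_point_part with (limit_radius r0); auto.
  - intros z psi Hz Hpsi.
    exact (squares_dense_no_derivation (S N) X _ z psi Hbd' Hsq Hz Hpsi).
  - intros z Hz.
    replace (fun x => hull (S N) X x /\ proj N x = z) with
      (fun x => Xh x /\ proj N x = z).
    + eapply limit_fibre_cantor; eauto.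
    + apply functional_extensionality; intro x; apply propositional_extensionality.
      rewrite Hhull; tauto.
Qed.
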